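(* Let $\mathbb{F}$ be a field, $\Gamma$ an arbitrary digraph and $A=L_{\mathbb{F}}(\Gamma)$ its Leavitt path algebra. Consider the Galois connection between the set of (two-sided) ideals of $A$ ordered by reverse inclusion and the set $2^{\mathcal{V}(A)}$ of subsets of $\mathcal{V}(A)$ ordered by inclusion given by $$\varphi(J)=\{[P]\in\mathcal{V}(A): [P]\perp J\},\qquad \psi(X)=\bigcap\{I\trianglelefteq A: [P]\perp I\text{ for all }[P]\in X\}.$$ This Galois connection gives a Galois correspondence between the graded ideals of $A$ and the closed submonoids of $\mathcal{V}(A)$: the image of $\psi$ is the set of graded ideals of $A$, the image of $\varphi$ is the set of closed submonoids of $\mathcal{V}(A)$, and $\varphi,\psi$ restrict to mutually inverse bijections between these two sets. This correspondence is a lattice isomorphism when both graded ideals and closed submonoids are ordered by inclusion.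
   Context: A digraph $\Gamma=(V,E,s,t)$ consists of arbitrary (possibly infinite) sets $V$ of vertices and $E$ of arrows and functions $s,t:E\to V$ (source, target). The Leavitt path algebra $L_{\mathbb{F}}(\Gamma)$ is the (not necessarily unital) $\mathbb{F}$-algebra generated by $V\sqcup E\sqcup\{e^*: e\in E\}$ subject to: $uv=\delta_{u,v}u$ for $u,v\in V$; $s(e)e=e=e\,t(e)$ and $t(e)e^*=e^*=e^*s(e)$ for $e\in E$; (CK1) $e^*f=\delta_{e,f}t(e)$; (CK2) $v=\sum_{s(e)=v}ee^*$ for every $v$ with $0<|s^{-1}(v)|<\infty$. It is $\mathbb{Z}$-graded with $\deg v=0$, $\deg e=1$, $\deg e^*=-1$; graded ideals are with respect to this grading. It has local units (finite sums of distinct vertices). Modules are unital right modules ($M=MA$). $\mathcal{V}(A)$ is the additive monoid of isomorphism classes $[P]$ of finitely generated projective $A$-modules under direct sum. $[P]\twoheadrightarrow[Q]$ means $[P]=[Q]+[Q']$ for some $[Q']\in\mathcal{V}(A)$ (equivalently, there is an epimorphism $P\to Q$). A submonoid $S$ of $\mathcal{V}(A)$ is closed if $[P]\in S$ and $[P]\twoheadrightarrow[Q]$ imply $[Q]\in S$. For an ideal $J$ of $A$, $[P]\perp J$ means $\mathrm{Hom}^A(P,A/J)=0$. *)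

(* Defs.v *)
From HB Require Import structures.
From mathcomp Require Import all_boot all_order all_algebra.
From mathcomp Require Import finmap.
From mathcomp Require Import all_classical.

Set Implicit Arguments.
Unset Strict Implicit.
Unset Printing Implicit Defensive.

Import Order.TTheory GRing.Theory Num.Theory.
Local Open Scope classical_set_scope.
Local Open Scope ring_scope.

Reserved Notation "a ** b" (at level 40, left associativity).
Reserved Notation "m |> a" (at level 40, left associativity).

HB.mixin Record Lmodule_isLocallyUnitalAlgebra (F : fieldType) A
    of GRing.Lmodule F A := {
  lumul : A -> A -> A;
  lumulA : associative lumul;
  lumulDl : left_distributive lumul +%R;
  lumulDr : right_distributive lumul +%R;
  lumulZl : forall (k : F) a b, lumul (k *: a) b = k *: lumul a b;
  lumulZr : forall (k : F) a b, lumul a (k *: b) = k *: lumul a b;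
  local_unit : forall s : seq A, exists u, lumul u u = u /\
    forall a, a \in s -> lumul u a = a /\ lumul a u = a
}.

#[short(type="luAlgType")]
HB.structure Definition LocallyUnitalAlgebra (F : fieldType) :=
  {A of Lmodule_isLocallyUnitalAlgebra F A & GRing.Lmodule F A}.

Notation "a ** b" := (lumul a b) : ring_scope.

(* Right A-modules with M = MA ([ract_unital]).  As A has local units, M = MA
   determines the F-structure of M from the action of A; ring-theoretic
   A-homomorphisms and ideals are then automatically F-linear, so recording F
   below changes neither the modules, nor the homomorphisms, nor the ideals. *)
HB.mixin Record Lmodule_isRModule (F : fieldType) (A : luAlgType F) M
    of GRing.Lmodule F M := {
  ract : M -> A -> M;
  ractA : forall m a b, ract m (a ** b) = ract (ract m a) b;
  ractDl : forall m n a, ract (m + n) a = ract m a + ract n a;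
  ractDr : forall m a b, ract m (a + b) = ract m a + ract m b;
  ractZl : forall (k : F) m a, ract (k *: m) a = k *: ract m a;
  ractZr : forall (k : F) m a, ract m (k *: a) = k *: ract m a;
  ract_unital : forall m, exists s : seq (M * A),
    m = \sum_(p <- s) ract p.1 p.2
}.

#[short(type="rmodType")]
HB.structure Definition RModule (F : fieldType) (A : luAlgType F) :=
  {M of Lmodule_isRModule F A M & GRing.Lmodule F M}.

Notation "m |> a" := (ract m a) : ring_scope.

Section LocallyUnitalTheory.
Context (F : fieldType) (A : luAlgType F).

Lemma lumul0 (a : A) : a ** 0 = 0.
Proof. by rewrite -(scale0r (0 : A)) lumulZr !scale0r. Qed.

Lemma lu0mul (a : A) : 0 ** a = 0.
Proof. by rewrite -(scale0r (0 : A)) lumulZl !scale0r. Qed.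

Lemma ract0 (M : rmodType A) (m : M) : m |> 0 = 0.
Proof. by rewrite -(scale0r (0 : A)) ractZr !scale0r. Qed.

Lemma r0act (M : rmodType A) (a : A) : (0 : M) |> a = 0.
Proof. by rewrite -(scale0r (0 : M)) ractZl !scale0r. Qed.

End LocallyUnitalTheory.

Section Homomorphisms.
Context (F : fieldType) (A : luAlgType F).

Definition is_rhom (M N : rmodType A) (f : M -> N) : Prop :=
  linear f /\ forall m a, f (m |> a) = f m |> a.

Definition isomorphic (M N : rmodType A) : Prop :=
  exists f : M -> N, is_rhom f /\ bijective f.

Definition finitely_generated (M : rmodType A) : Prop :=
  exists (n : nat) (g : 'I_n -> M),
    forall m, exists a : 'I_n -> A, m = \sum_i g i |> a i.

Definition projective (P : rmodType A) : Prop :=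
  forall (M N : rmodType A) (g : M -> N) (f : P -> N),
    is_rhom g -> (forall y, exists x, g x = y) -> is_rhom f ->
    exists h : P -> M, is_rhom h /\ forall x, g (h x) = f x.

Lemma rhomD (M N : rmodType A) (f : M -> N) : is_rhom f -> {morph f : x y / x + y}.
Proof. by move=> [fl _] x y; rewrite -[x]scale1r fl !scale1r. Qed.

Lemma rhom0 (M N : rmodType A) (f : M -> N) : is_rhom f -> f 0 = 0.
Proof. by move=> fh; apply: (addrI (f 0)); rewrite -rhomD// !addr0. Qed.

Lemma rhomZ (M N : rmodType A) (f : M -> N) :
  is_rhom f -> forall k x, f (k *: x) = k *: f x.
Proof. by move=> fh k x; rewrite -[k *: x]addr0 fh.1 (rhom0 fh) addr0. Qed.

Lemma rhom_comp (M N P : rmodType A) (f : M -> N) (g : N -> P) :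
  is_rhom f -> is_rhom g -> is_rhom (g \o f).
Proof.
move=> [fl fa] [gl ga]; split=> [k x y|m a] /=; first by rewrite fl gl.
by rewrite fa ga.
Qed.

Lemma isomorphic_refl (M : rmodType A) : isomorphic M M.
Proof. by exists id; split; [split|exists id]. Qed.

Lemma isomorphic_sym (M N : rmodType A) : isomorphic M N -> isomorphic N M.
Proof.
move=> [f [fh [g fK gK]]]; exists g; split; last by exists f.
split=> [k x y|m a]; apply: (can_inj fK).
- by rewrite fh.1 !gK.
- by rewrite fh.2 !gK.
Qed.

Lemma isomorphic_trans (M N P : rmodType A) :
  isomorphic M N -> isomorphic N P -> isomorphic M P.
Proof.
move=> [f [fh fb]] [g [gh gb]]; exists (g \o f); split; first exact: rhom_comp.
exact: bij_comp.
Qed.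

End Homomorphisms.

Section DirectSum.
Context (F : fieldType) (A : luAlgType F) (M N : rmodType A).

Let sum_pair I (r : seq I) (f : I -> M) (g : I -> N) :
  \sum_(i <- r) (f i, g i) = (\sum_(i <- r) f i, \sum_(i <- r) g i).
Proof.
by rewrite [LHS]surjective_pairing (raddf_sum fst) (raddf_sum snd).
Qed.

Let pairD (x x' : M) (y y' : N) : (x + x', y + y') = (x, y) + (x', y').
Proof. by []. Qed.

Let act (m : (M * N)%type) (a : A) : (M * N)%type := (m.1 |> a, m.2 |> a).

Let actA m a b : act m (a ** b) = act (act m a) b.
Proof. by rewrite /act !ractA. Qed.

Let actDl m n a : act (m + n) a = act m a + act n a.
Proof. by rewrite /act !ractDl. Qed.

Let actDr m a b : act m (a + b) = act m a + act m b.
Proof. by rewrite /act !ractDr. Qed.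

Let actZl (k : F) m a : act (k *: m) a = k *: act m a.
Proof. by rewrite /act !ractZl. Qed.

Let actZr (k : F) m a : act m (k *: a) = k *: act m a.
Proof. by rewrite /act !ractZr. Qed.

Let act_unital m : exists s : seq ((M * N) * A),
  m = \sum_(p <- s) act p.1 p.2.
Proof.
case: m => x y.
have [s1 ->] := ract_unital x; have [s2 ->] := ract_unital y.
exists ([seq ((p.1, 0), p.2) | p <- s1] ++ [seq ((0, p.1), p.2) | p <- s2]).
rewrite big_cat !big_map /= !sum_pair -pairD /=.
rewrite [X in (_ + X, _)]big1 ?[X in (_, X + _)]big1 ?addr0 ?add0r// => i _;
exact: r0act.
Qed.

HB.instance Definition _ := Lmodule_isRModule.Build F A (M * N)%type
  actA actDl actDr actZl actZr act_unital.

Lemma finitely_generated_pair :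
  finitely_generated M -> finitely_generated N ->
  finitely_generated (M * N)%type.
Proof.
move=> [n1 [g1 G1]] [n2 [g2 G2]]; exists (n1 + n2)%N.
exists (fun i : 'I_(n1 + n2) => match fintype.split i with inl j => (g1 j, 0) | inr k => (0, g2 k) end).
move=> [x y]; have [a1 ->] := G1 x; have [a2 ->] := G2 y.
exists (fun i : 'I_(n1 + n2) => match fintype.split i with inl j => a1 j | inr k => a2 k end).
rewrite big_split_ord /=.
rewrite (eq_bigr (fun i => (g1 i |> a1 i, 0 |> a1 i))); last first.
  by move=> i _; rewrite (unsplitK (inl i)).
rewrite [X in _ = _ + X](eq_bigr (fun i => (0 |> a2 i, g2 i |> a2 i))); last first.
  by move=> i _; rewrite (unsplitK (inr i)).
rewrite !sum_pair -pairD.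
rewrite [X in (_ + X, _)]big1 ?[X in (_, X + _)]big1 ?addr0 ?add0r// => i _;
exact: r0act.
Qed.

Lemma projective_pair :
  projective M -> projective N -> projective (M * N)%type.
Proof.
move=> PM PN L K g f gh gs fh.
have ih1 : is_rhom (fun x : M => (x, 0) : (M * N)%type).
  split=> [k x y|m a]; congr pair; first by rewrite /= scaler0 addr0.
  by rewrite /= r0act.
have ih2 : is_rhom (fun x : N => (0, x) : (M * N)%type).
  split=> [k x y|m a]; congr pair; first by rewrite /= scaler0 addr0.
  by rewrite /= r0act.
have [h1 [h1h H1]] := PM L K g _ gh gs (rhom_comp ih1 fh).
have [h2 [h2h H2]] := PN L K g _ gh gs (rhom_comp ih2 fh).
exists (fun p => h1 p.1 + h2 p.2); split.
  split=> [k x y|m a] /=; last by rewrite h1h.2 h2h.2 ractDl.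
  by rewrite h1h.1 h2h.1 scalerDr addrACA.
move=> [x y] /=; rewrite (rhomD gh) H1 H2 /= -(rhomD fh).
by congr f; congr pair; rewrite /= ?addr0 ?add0r.
Qed.

End DirectSum.

Definition zero_module (F : fieldType) (A : luAlgType F) : Type := 'rV[F]_0.

Section ZeroModule.
Context (F : fieldType) (A : luAlgType F).
Local Notation Z := (zero_module A).

HB.instance Definition _ := GRing.Lmodule.on Z.

Let zero_eq (x y : Z) : x = y.
Proof. by rewrite (thinmx0 x) (thinmx0 y). Qed.

Let act (m : Z) (a : A) : Z := 0.

Let act_unital m : exists s : seq (Z * A), m = \sum_(p <- s) act p.1 p.2.
Proof. by exists [::]; exact: zero_eq. Qed.

HB.instance Definition _ := Lmodule_isRModule.Build F A Z
  (fun _ _ _ => zero_eq _ _) (fun _ _ _ => zero_eq _ _)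
  (fun _ _ _ => zero_eq _ _) (fun _ _ _ => zero_eq _ _)
  (fun _ _ _ => zero_eq _ _) act_unital.

Lemma finitely_generated0 : finitely_generated Z.
Proof.
exists 0%N, (fun=> 0) => m; exists (fun=> 0); exact: zero_eq.
Qed.

Lemma projective0 : projective Z.
Proof.
move=> M N g f gh _ fh; exists (fun=> 0); split.
  by split=> [k x y|m a]; rewrite ?scaler0 ?addr0 ?r0act.
by move=> x; rewrite (rhom0 gh) (zero_eq x 0) (rhom0 fh).
Qed.

Lemma zero_module_eq (x y : Z) : x = y. Proof. exact: zero_eq. Qed.

End ZeroModule.

Record fgproj (F : fieldType) (A : luAlgType F) := Fgproj {
  fgproj_mod :> rmodType A;
  fgproj_fg : finitely_generated fgproj_mod;
  fgproj_proj : projective fgproj_mod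
}.

(* V(A).  Its elements are the isomorphism classes themselves; the type lives
   in a universe above that of [eqType], [set] and [nmodType], so subsets of it
   are plain predicates and its monoid structure is given by [vzero], [vadd]. *)
Record vmonoid (F : fieldType) (A : luAlgType F) := VMonoid {
  vclass : fgproj A -> Prop;
  vclass_ex : exists P : fgproj A, vclass = (fun Q : fgproj A => isomorphic P Q)
}.

Section VMonoid.
Context (F : fieldType) (A : luAlgType F).
Implicit Types (P Q R : fgproj A) (p q r : vmonoid A).

Definition iso_class P : vmonoid A := VMonoid (ex_intro _ P erefl).

Lemma vmonoid_eq p q : (forall P, vclass p P <-> vclass q P) -> p = q.
Proof.
case: p q => [X hX] [Y hY] /= XY.
have E : X = Y by apply: functional_extensionality_dep => P; exact/propext/XY.
by case: Y / E hY {XY} => hY; congr VMonoid; exact: Prop_irrelevance.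
Qed.

Lemma iso_classP P Q : iso_class P = iso_class Q <-> isomorphic P Q.
Proof.
split=> [/(congr1 (fun p => vclass p Q)) /= ->|PQ]; first exact: isomorphic_refl.
apply: vmonoid_eq => R /=; split; apply: isomorphic_trans => //.
exact: isomorphic_sym.
Qed.

Lemma iso_class_surj p : exists P, p = iso_class P.
Proof. by case: p => X [P XE]; exists P; apply: vmonoid_eq => Q /=; rewrite XE. Qed.

Definition fgproj_zero : fgproj A :=
  Fgproj (finitely_generated0 A) (projective0 (A := A)).

Definition fgproj_sum P Q : fgproj A :=
  Fgproj (finitely_generated_pair (fgproj_fg P) (fgproj_fg Q))
         (projective_pair (fgproj_proj (f := P)) (fgproj_proj (f := Q))).

Lemma isomorphic_sum P P' Q Q' : isomorphic P P' -> isomorphic Q Q' ->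
  isomorphic (fgproj_sum P Q) (fgproj_sum P' Q').
Proof.
move=> [f [fh [f' fK f'K]]] [g [gh [g' gK g'K]]].
exists (fun x : P * Q => (f x.1, g x.2)); split.
  split=> [k x y|m a] /=; first by rewrite fh.1 gh.1.
  by rewrite fh.2 gh.2.
by exists (fun x => (f' x.1, g' x.2)) => -[x y] /=; rewrite ?fK ?gK ?f'K ?g'K.
Qed.

Definition vzero : vmonoid A := iso_class fgproj_zero.

Definition vadd_class p q R : Prop :=
  exists P Q, [/\ vclass p P, vclass q Q & isomorphic (fgproj_sum P Q) R].

Lemma vadd_class_ex p q :
  exists P, vadd_class p q = (fun Q : fgproj A => isomorphic P Q).
Proof.
have [P ->] := iso_class_surj p; have [Q ->] := iso_class_surj q.
exists (fgproj_sum P Q); apply: functional_extensionality_dep => R.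
apply/propext; split=> [[P' [Q' [/= PP QQ]]]|PQR].
  by apply: isomorphic_trans; exact: isomorphic_sum.
by exists P, Q; split=> //; exact: isomorphic_refl.
Qed.

Definition vadd p q : vmonoid A := VMonoid (vadd_class_ex p q).

Lemma vadd_iso_class P Q :
  vadd (iso_class P) (iso_class Q) = iso_class (fgproj_sum P Q).
Proof.
apply: vmonoid_eq => R /=; split=> [[P' [Q' [/= PP QQ]]]|PQR].
  by apply: isomorphic_trans; exact: isomorphic_sum.
by exists P, Q; split=> //; exact: isomorphic_refl.
Qed.

Lemma vaddC : commutative vadd.
Proof.
move=> p q; have [P ->] := iso_class_surj p; have [Q ->] := iso_class_surj q.
rewrite !vadd_iso_class; apply/iso_classP.
exists (fun x : P * Q => (x.2, x.1)); split; first by split.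
by exists (fun x => (x.2, x.1)) => -[].
Qed.

Lemma vaddA : associative vadd.
Proof.
move=> p q r; have [P ->] := iso_class_surj p.
have [Q ->] := iso_class_surj q; have [R ->] := iso_class_surj r.
rewrite !vadd_iso_class; apply/iso_classP.
exists (fun x : P * (Q * R) => ((x.1, x.2.1), x.2.2)); split; first by split.
by exists (fun x => (x.1.1, (x.1.2, x.2))) => [[x [y z]]|[[x y] z]].
Qed.

Lemma vadd0 : left_id vzero vadd.
Proof.
move=> p; have [P ->] := iso_class_surj p.
rewrite vadd_iso_class; apply/iso_classP.
exists (fun x : zero_module A * P => x.2); split; first by split.
exists (fun x => (0, x)) => // -[x y]; congr pair; exact: zero_module_eq.
Qed.

Definition epi_class p q : Prop := exists r, p = vadd q r.

Definition closed_submonoid (S : vmonoid A -> Prop) : Prop :=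
  [/\ S vzero,
      forall p q, S p -> S q -> S (vadd p q) &
      forall p q, S p -> epi_class p q -> S q].

End VMonoid.

Section Ideals.
Context (F : fieldType) (A : luAlgType F).

Definition is_ideal (J : A -> Prop) : Prop :=
  [/\ J 0,
      forall x y, J x -> J y -> J (x + y),
      forall (k : F) x, J x -> J (k *: x),
      forall a x, J x -> J (a ** x) &
      forall a x, J x -> J (x ** a)].

Record ideal := Ideal { ideal_set :> A -> Prop; ideal_axiom : is_ideal ideal_set }.

Lemma ideal_eq (I J : ideal) : ideal_set I = J -> I = J.
Proof.
by case: I J => [I hI] [J hJ] /= E; case: J / E hJ => hJ; congr Ideal;
  exact: Prop_irrelevance.
Qed.

Section Quotient.
Variable J : ideal.

Definition ideal_pred : {pred A} := [pred x | `[< J x >]].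

Lemma ideal_predP x : reflect (J x) (x \in ideal_pred).
Proof. exact: asboolP. Qed.

Let ideal_zmod_closed : zmod_closed ideal_pred.
Proof.
have [J0 JD JZ _ _] := ideal_axiom J; split; first exact/ideal_predP.
move=> x y /ideal_predP Jx /ideal_predP Jy; apply/ideal_predP.
by rewrite -scaleN1r; apply: JD => //; exact: JZ.
Qed.

HB.instance Definition _ := GRing.isZmodClosed.Build A ideal_pred ideal_zmod_closed.

Definition quot_module : Type := Quotient.quot (ideal_pred : zmodClosed A).

HB.instance Definition _ := GRing.Zmodule.on quot_module.

Definition quot_proj (x : A) : quot_module :=
  \pi_(Quotient.quot (ideal_pred : zmodClosed A))%qT x.

Lemma quot_projP x y : quot_proj x = quot_proj y <-> J (x - y).
Proof.
split=> [E|Jxy].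
  by apply/ideal_predP; rewrite Quotient.idealrBE; exact/eqP.
by apply/eqP; rewrite -Quotient.idealrBE; exact/ideal_predP.
Qed.

Lemma quot_proj_surj (q : quot_module) : exists x, q = quot_proj x.
Proof. by exists (repr q); rewrite /quot_proj reprK. Qed.

Lemma quot_projD x y : quot_proj (x + y) = quot_proj x + quot_proj y.
Proof. by rewrite /quot_proj !piE. Qed.

Let scale (k : F) (q : quot_module) : quot_module := quot_proj (k *: repr q).

Let scaleE k x : scale k (quot_proj x) = quot_proj (k *: x).
Proof.
apply/quot_projP; rewrite -scalerBr; have [_ _ JZ _ _] := ideal_axiom J.
by apply: JZ; apply/quot_projP; rewrite /quot_proj reprK.
Qed.

Let scaleA (a b : F) v : scale a (scale b v) = scale (a * b) v.
Proof. by have [x ->] := quot_proj_surj v; rewrite !scaleE scalerA. Qed.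

Let scale1 : left_id 1 scale.
Proof. by move=> v; have [x ->] := quot_proj_surj v; rewrite scaleE scale1r. Qed.

Let scaleDr : right_distributive scale +%R.
Proof.
move=> k u v; have [x ->] := quot_proj_surj u; have [y ->] := quot_proj_surj v.
by rewrite -quot_projD !scaleE scalerDr quot_projD.
Qed.

Let scaleDl v : {morph scale^~ v : a b / a + b}.
Proof.
move=> a b; have [x ->] := quot_proj_surj v.
by rewrite !scaleE scalerDl quot_projD.
Qed.

HB.instance Definition _ := GRing.Zmodule_isLmodule.Build F quot_module
  scaleA scale1 scaleDr scaleDl.

Lemma quot_projZ k x : quot_proj (k *: x) = k *: quot_proj x.
Proof. by rewrite -scaleE. Qed.

Let act (q : quot_module) (a : A) : quot_module := quot_proj (repr q ** a).

Lemma lumulBl (x y a : A) : (x - y) ** a = x ** a - y ** a.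
Proof. by rewrite lumulDl -scaleN1r lumulZl scaleN1r. Qed.

Let actE x a : act (quot_proj x) a = quot_proj (x ** a).
Proof.
apply/quot_projP; rewrite -lumulBl; have [_ _ _ _ JM] := ideal_axiom J.
by apply: JM; apply/quot_projP; rewrite /quot_proj reprK.
Qed.

Let actA m a b : act m (a ** b) = act (act m a) b.
Proof. by have [x ->] := quot_proj_surj m; rewrite !actE lumulA. Qed.

Let actDl m n a : act (m + n) a = act m a + act n a.
Proof.
have [x ->] := quot_proj_surj m; have [y ->] := quot_proj_surj n.
by rewrite -quot_projD !actE lumulDl quot_projD.
Qed.

Let actDr m a b : act m (a + b) = act m a + act m b.
Proof.
by have [x ->] := quot_proj_surj m; rewrite !actE lumulDr quot_projD.
Qed.

Let actZl (k : F) m a : act (k *: m) a = k *: act m a.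
Proof.
by have [x ->] := quot_proj_surj m; rewrite -quot_projZ !actE lumulZl quot_projZ.
Qed.

Let actZr (k : F) m a : act m (k *: a) = k *: act m a.
Proof. by have [x ->] := quot_proj_surj m; rewrite !actE lumulZr quot_projZ. Qed.

Let act_unital m : exists s : seq (quot_module * A),
  m = \sum_(p <- s) act p.1 p.2.
Proof.
have [x ->] := quot_proj_surj m; have [u [_ /(_ x)]] := local_unit [:: x].
rewrite mem_head => /(_ isT)[_ xu]; exists [:: (quot_proj x, u)].
by rewrite big_seq1 actE xu.
Qed.

HB.instance Definition _ := Lmodule_isRModule.Build F A quot_module
  actA actDl actDr actZl actZr act_unital.

Lemma quot_projM x a : quot_proj (x ** a) = quot_proj x |> a.
Proof. by rewrite -actE. Qed.

End Quotient.

Definition perp (P : fgproj A) (J : ideal) : Prop :=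
  forall f : P -> quot_module J, is_rhom f -> forall x, f x = 0.

Definition phi (J : ideal) : vmonoid A -> Prop :=
  fun p => exists P : fgproj A, p = iso_class P /\ perp P J.

Definition psi_set (X : vmonoid A -> Prop) : A -> Prop :=
  fun a => forall I : ideal, (forall P, X (iso_class P) -> perp P I) -> I a.

Lemma psi_ideal X : is_ideal (psi_set X).
Proof.
split=> [I XI|x y hx hy I XI|k x hx I XI|a x hx I XI|a x hx I XI];
  have [I0 ID IZ IMl IMr] := ideal_axiom I => //.
- by apply: ID; [exact: hx|exact: hy].
- by apply: IZ; exact: hx.
- by apply: IMl; exact: hx.
- by apply: IMr; exact: hx.
Qed.

Definition psi (X : vmonoid A -> Prop) : ideal := Ideal (psi_ideal X).

Definition ideal_le (I J : ideal) : Prop := forall a, I a -> J a.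

Definition vsubset (X Y : vmonoid A -> Prop) : Prop := forall p, X p -> Y p.

End Ideals.

Section Lattices.
Variables (T U : Type).
Implicit Types (C : T -> Prop) (le : T -> T -> Prop) (x y z : T).

Definition is_join C le x y z : Prop :=
  [/\ C z, le x z, le y z & forall w, C w -> le x w -> le y w -> le z w].

Definition is_meet C le x y z : Prop :=
  [/\ C z, le z x, le z y & forall w, C w -> le w x -> le w y -> le w z].

Definition is_lattice C le : Prop :=
  [/\ forall x, C x -> le x x,
      forall x y, C x -> C y -> le x y -> le y x -> x = y,
      forall x y z, C x -> C y -> C z -> le x y -> le y z -> le x z,
      forall x y, C x -> C y -> exists z, is_join C le x y z &
      forall x y, C x -> C y -> exists z, is_meet C le x y z].

Definition inverse_bijections C (D : U -> Prop) (f : T -> U) (g : U -> T) : Prop :=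
  [/\ forall x, C x -> D (f x),
      forall y : U, D y -> C (g y),
      forall x, C x -> g (f x) = x &
      forall y : U, D y -> f (g y) = y].

End Lattices.

Definition lattice_morphism (T U : Type) (C : T -> Prop) (leT : T -> T -> Prop)
    (D : U -> Prop) (leU : U -> U -> Prop) (f : T -> U) : Prop :=
  forall x y z, C x -> C y ->
    (is_join C leT x y z -> is_join D leU (f x) (f y) (f z)) /\
    (is_meet C leT x y z -> is_meet D leU (f x) (f y) (f z)).

Record digraph := Digraph {
  vertex : Type;
  arrow : Type;
  src : arrow -> vertex;
  tgt : arrow -> vertex
}.

HB.instance Definition _ (G : digraph) := gen_eqMixin (vertex G).
HB.instance Definition _ (G : digraph) := gen_choiceMixin (vertex G).
HB.instance Definition _ (G : digraph) := gen_eqMixin (arrow G).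
HB.instance Definition _ (G : digraph) := gen_choiceMixin (arrow G).

Definition emitted (G : digraph) (v : vertex G) : set (arrow G) :=
  [set e | src e = v].

(* [LGhost e] is the generator e^*. *)
Inductive lpa_term (F : fieldType) (G : digraph) : Type :=
| LVertex of vertex G
| LArrow of arrow G
| LGhost of arrow G
| LZero
| LOpp of lpa_term F G
| LAdd of lpa_term F G & lpa_term F G
| LScale of F & lpa_term F G
| LMul of lpa_term F G & lpa_term F G.

Arguments LVertex {F G}.
Arguments LArrow {F G}.
Arguments LGhost {F G}.
Arguments LZero {F G}.

(* The smallest congruence on terms for which the quotient is an associative
   (not necessarily unital) algebra satisfying the defining relations. *)
Inductive lpa_eq (F : fieldType) (G : digraph) :
  lpa_term F G -> lpa_term F G -> Prop :=
| lpa_refl x : lpa_eq x x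
| lpa_sym x y : lpa_eq x y -> lpa_eq y x
| lpa_trans x y z : lpa_eq x y -> lpa_eq y z -> lpa_eq x z
| lpa_opp_congr x x' : lpa_eq x x' -> lpa_eq (LOpp x) (LOpp x')
| lpa_add_congr x x' y y' :
    lpa_eq x x' -> lpa_eq y y' -> lpa_eq (LAdd x y) (LAdd x' y')
| lpa_scale_congr k x x' : lpa_eq x x' -> lpa_eq (LScale k x) (LScale k x')
| lpa_mul_congr x x' y y' :
    lpa_eq x x' -> lpa_eq y y' -> lpa_eq (LMul x y) (LMul x' y')
| lpa_addA x y z : lpa_eq (LAdd x (LAdd y z)) (LAdd (LAdd x y) z)
| lpa_addC x y : lpa_eq (LAdd x y) (LAdd y x)
| lpa_add0 x : lpa_eq (LAdd LZero x) x
| lpa_addN x : lpa_eq (LAdd (LOpp x) x) LZero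
| lpa_scaleA k l x : lpa_eq (LScale k (LScale l x)) (LScale (k * l) x)
| lpa_scale1 x : lpa_eq (LScale 1 x) x
| lpa_scaleDr k x y :
    lpa_eq (LScale k (LAdd x y)) (LAdd (LScale k x) (LScale k y))
| lpa_scaleDl k l x :
    lpa_eq (LScale (k + l) x) (LAdd (LScale k x) (LScale l x))
| lpa_mulA x y z : lpa_eq (LMul x (LMul y z)) (LMul (LMul x y) z)
| lpa_mulDl x y z : lpa_eq (LMul (LAdd x y) z) (LAdd (LMul x z) (LMul y z))
| lpa_mulDr x y z : lpa_eq (LMul x (LAdd y z)) (LAdd (LMul x y) (LMul x z))
| lpa_mulZl k x y : lpa_eq (LMul (LScale k x) y) (LScale k (LMul x y))
| lpa_mulZr k x y : lpa_eq (LMul x (LScale k y)) (LScale k (LMul x y))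
| lpa_vertex u v : lpa_eq (LMul (LVertex u) (LVertex v))
    (if u == v then LVertex u else LZero)
| lpa_src_arrow e : lpa_eq (LMul (LVertex (src e)) (LArrow e)) (LArrow e)
| lpa_arrow_tgt e : lpa_eq (LMul (LArrow e) (LVertex (tgt e))) (LArrow e)
| lpa_tgt_ghost e : lpa_eq (LMul (LVertex (tgt e)) (LGhost e)) (LGhost e)
| lpa_ghost_src e : lpa_eq (LMul (LGhost e) (LVertex (src e))) (LGhost e)
| lpa_ck1 e f : lpa_eq (LMul (LGhost e) (LArrow f))
    (if e == f then LVertex (tgt e) else LZero)
| lpa_ck2 v : emitted v !=set0 -> finite_set (emitted v) ->
    lpa_eq (LVertex v)
      (\big[@LAdd F G/LZero]_(e <- fset_set (emitted v))
         LMul (LArrow e) (LGhost e)).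

Section LeavittPathAlgebra.
Context (F : fieldType) (G : digraph).
Local Notation term := (lpa_term F G).

HB.instance Definition _ := gen_eqMixin term.
HB.instance Definition _ := gen_choiceMixin term.

Definition lpa_rel (x y : term) : bool := `[< lpa_eq x y >].

Let lpa_rel_refl : reflexive lpa_rel.
Proof. by move=> x; apply/asboolP; exact: lpa_refl. Qed.

Let lpa_rel_sym : symmetric lpa_rel.
Proof. by move=> x y; apply/asboolP/asboolP; exact: lpa_sym. Qed.

Let lpa_rel_trans : transitive lpa_rel.
Proof.
by move=> y x z /asboolP xy /asboolP yz; apply/asboolP; exact: lpa_trans yz.
Qed.

Canonical lpa_equiv := EquivRel lpa_rel lpa_rel_refl lpa_rel_sym lpa_rel_trans.

Definition lpa : Type := {eq_quot lpa_equiv}%qT.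

HB.instance Definition _ := Choice.on lpa.

Definition lpa_pi (x : term) : lpa := \pi_({eq_quot lpa_equiv})%qT x.

Lemma lpa_piP x y : lpa_pi x = lpa_pi y <-> lpa_eq x y.
Proof.
by split=> [/eqmodP/asboolP//|xy]; apply/eqmodP/asboolP.
Qed.

Lemma lpa_pi_surj (a : lpa) : exists x, a = lpa_pi x.
Proof. by exists (repr a); rewrite /lpa_pi reprK. Qed.

Lemma lpa_reprK x : lpa_eq (repr (lpa_pi x)) x.
Proof. by apply/lpa_piP; rewrite /lpa_pi reprK. Qed.

Definition lpa_zero : lpa := lpa_pi LZero.
Definition lpa_opp (a : lpa) : lpa := lpa_pi (LOpp (repr a)).
Definition lpa_add (a b : lpa) : lpa := lpa_pi (LAdd (repr a) (repr b)).
Definition lpa_scale (k : F) (a : lpa) : lpa := lpa_pi (LScale k (repr a)).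
Definition lpa_mul (a b : lpa) : lpa := lpa_pi (LMul (repr a) (repr b)).

Let oppE x : lpa_opp (lpa_pi x) = lpa_pi (LOpp x).
Proof. by apply/lpa_piP/lpa_opp_congr/lpa_reprK. Qed.

Let addE x y : lpa_add (lpa_pi x) (lpa_pi y) = lpa_pi (LAdd x y).
Proof. by apply/lpa_piP/lpa_add_congr; exact: lpa_reprK. Qed.

Let scaleE k x : lpa_scale k (lpa_pi x) = lpa_pi (LScale k x).
Proof. by apply/lpa_piP/lpa_scale_congr/lpa_reprK. Qed.

Let mulE x y : lpa_mul (lpa_pi x) (lpa_pi y) = lpa_pi (LMul x y).
Proof. by apply/lpa_piP/lpa_mul_congr; exact: lpa_reprK. Qed.

Let addA : associative lpa_add.
Proof.
move=> a b c; have [x ->] := lpa_pi_surj a; have [y ->] := lpa_pi_surj b.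
by have [z ->] := lpa_pi_surj c; rewrite !addE; exact/lpa_piP/lpa_addA.
Qed.

Let addC : commutative lpa_add.
Proof.
move=> a b; have [x ->] := lpa_pi_surj a; have [y ->] := lpa_pi_surj b.
by rewrite !addE; exact/lpa_piP/lpa_addC.
Qed.

Let add0 : left_id lpa_zero lpa_add.
Proof.
by move=> a; have [x ->] := lpa_pi_surj a; rewrite !addE; exact/lpa_piP/lpa_add0.
Qed.

Let addN : left_inverse lpa_zero lpa_opp lpa_add.
Proof.
move=> a; have [x ->] := lpa_pi_surj a.
by rewrite oppE addE; exact/lpa_piP/lpa_addN.
Qed.

HB.instance Definition _ := GRing.isZmodule.Build lpa addA addC add0 addN.

Let scaleA k l a : lpa_scale k (lpa_scale l a) = lpa_scale (k * l) a.
Proof.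
by have [x ->] := lpa_pi_surj a; rewrite !scaleE; exact/lpa_piP/lpa_scaleA.
Qed.

Let scale1 : left_id 1 lpa_scale.
Proof.
by move=> a; have [x ->] := lpa_pi_surj a; rewrite scaleE; exact/lpa_piP/lpa_scale1.
Qed.

Let scaleDr : right_distributive lpa_scale +%R.
Proof.
move=> k a b; have [x ->] := lpa_pi_surj a; have [y ->] := lpa_pi_surj b.
rewrite /+%R /= !(addE, scaleE); exact/lpa_piP/lpa_scaleDr.
Qed.

Let scaleDl a : {morph lpa_scale^~ a : k l / k + l}.
Proof.
move=> k l; have [x ->] := lpa_pi_surj a; rewrite !scaleE.
rewrite [RHS]addE; exact/lpa_piP/lpa_scaleDl.
Qed.

HB.instance Definition _ := GRing.Zmodule_isLmodule.Build F lpa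
  scaleA scale1 scaleDr scaleDl.

Lemma lpa_piD x y : lpa_pi (LAdd x y) = lpa_pi x + lpa_pi y.
Proof. by rewrite -addE. Qed.

Lemma lpa_piN x : lpa_pi (LOpp x) = - lpa_pi x.
Proof. by rewrite -oppE. Qed.

Lemma lpa_piZ k x : lpa_pi (LScale k x) = k *: lpa_pi x.
Proof. by rewrite -scaleE. Qed.

Let mulA : associative lpa_mul.
Proof.
move=> a b c; have [x ->] := lpa_pi_surj a; have [y ->] := lpa_pi_surj b.
by have [z ->] := lpa_pi_surj c; rewrite !mulE; exact/lpa_piP/lpa_mulA.
Qed.

Let mulDl : left_distributive lpa_mul +%R.
Proof.
move=> a b c; have [x ->] := lpa_pi_surj a; have [y ->] := lpa_pi_surj b.
have [z ->] := lpa_pi_surj c.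
by rewrite -lpa_piD !mulE -lpa_piD; exact/lpa_piP/lpa_mulDl.
Qed.

Let mulDr : right_distributive lpa_mul +%R.
Proof.
move=> a b c; have [x ->] := lpa_pi_surj a; have [y ->] := lpa_pi_surj b.
have [z ->] := lpa_pi_surj c.
by rewrite -lpa_piD !mulE -lpa_piD; exact/lpa_piP/lpa_mulDr.
Qed.

Let mulZl (k : F) (a b : lpa) : lpa_mul (k *: a) b = k *: lpa_mul a b.
Proof.
have [x ->] := lpa_pi_surj a; have [y ->] := lpa_pi_surj b.
by rewrite -lpa_piZ !mulE -lpa_piZ; exact/lpa_piP/lpa_mulZl.
Qed.

Let mulZr (k : F) (a b : lpa) : lpa_mul a (k *: b) = k *: lpa_mul a b.
Proof.
have [x ->] := lpa_pi_surj a; have [y ->] := lpa_pi_surj b.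
by rewrite -lpa_piZ !mulE -lpa_piZ; exact/lpa_piP/lpa_mulZr.
Qed.

Let mulr0 a : lpa_mul a 0 = 0.
Proof. by rewrite -(scale0r (0 : lpa)) mulZr !scale0r. Qed.

Let mul0r a : lpa_mul 0 a = 0.
Proof. by rewrite -(scale0r (0 : lpa)) mulZl !scale0r. Qed.

Let vtx v := lpa_pi (LVertex v).
Let vsum (l : seq (vertex G)) : lpa := \sum_(v <- l) vtx v.

Let vtxM u v : lpa_mul (vtx u) (vtx v) = if u == v then vtx u else 0.
Proof. by rewrite mulE; case: eqP (lpa_vertex F u v) => _ /lpa_piP. Qed.

Let vsum_vtx l v : uniq l -> v \in l -> lpa_mul (vsum l) (vtx v) = vtx v.
Proof.
move=> lU vl; rewrite /vsum (big_morph (lpa_mul^~ (vtx v)) (fun a b => mulDl a b _) (mul0r _)).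
rewrite (bigD1_seq v)//= vtxM eqxx big1 ?addr0// => u uv.
by rewrite vtxM (negPf uv).
Qed.

Let vtx_vsum l v : uniq l -> v \in l -> lpa_mul (vtx v) (vsum l) = vtx v.
Proof.
move=> lU vl; rewrite /vsum (big_morph (lpa_mul (vtx v)) (mulDr _) (mulr0 _)).
rewrite (bigD1_seq v)//= vtxM eqxx big1 ?addr0// => u uv.
by rewrite vtxM eq_sym (negPf uv).
Qed.

Let supported (l : seq (vertex G)) (a : lpa) := forall l', uniq l' ->
  {subset l <= l'} -> lpa_mul (vsum l') a = a /\ lpa_mul a (vsum l') = a.

Let supported_edge u v a : lpa_mul (vtx u) a = a -> lpa_mul a (vtx v) = a ->
  supported [:: u; v] a.
Proof.
move=> ua av l lU lS; split.
  by rewrite -ua mulA vsum_vtx// lS// !inE eqxx.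
by rewrite -av -mulA vtx_vsum// lS// !inE eqxx orbT.
Qed.

Let supported_ex (a : lpa) : exists l, supported l a.
Proof.
have [x {a}->] := lpa_pi_surj a.
elim: x => [v|e|e||x [l lx]|x [lx Hx] y [ly Hy]|k x [l lx]|x [lx Hx] y [ly Hy]].
- by exists [:: v; v]; apply: supported_edge; rewrite vtxM eqxx.
- exists [:: src e; tgt e]; apply: supported_edge; rewrite mulE; apply/lpa_piP.
    exact: lpa_src_arrow.
  exact: lpa_arrow_tgt.
- exists [:: tgt e; src e]; apply: supported_edge; rewrite mulE; apply/lpa_piP.
    exact: lpa_tgt_ghost.
  exact: lpa_ghost_src.
- by exists [::] => l _ _; rewrite mulr0 mul0r.
- exists l => l' lU /(lx _ lU)[E1 E2]; rewrite lpa_piN -scaleN1r.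
  by rewrite mulZl mulZr E1 E2.
- exists (lx ++ ly) => l' lU lS; rewrite lpa_piD.
  have [E1 E2] := Hx l' lU (fun z zl => lS z (ltac:(by rewrite mem_cat zl))).
  have [E3 E4] := Hy l' lU (fun z zl => lS z (ltac:(by rewrite mem_cat zl orbT))).
  by rewrite mulDl mulDr E1 E2 E3 E4.
- exists l => l' lU /(lx _ lU)[E1 E2]; rewrite lpa_piZ.
  by rewrite mulZl mulZr E1 E2.
- exists (lx ++ ly) => l' lU lS; rewrite -mulE.
  have [E1 _] := Hx l' lU (fun z zl => lS z (ltac:(by rewrite mem_cat zl))).
  have [_ E4] := Hy l' lU (fun z zl => lS z (ltac:(by rewrite mem_cat zl orbT))).
  by rewrite mulA E1 -mulA E4.
Qed.

Let lpa_local_unit (s : seq lpa) : exists u, lpa_mul u u = u /\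
  forall a, a \in s -> lpa_mul u a = a /\ lpa_mul a u = a.
Proof.
have [l lP] : exists l, forall a, a \in s -> supported l a.
  elim: s => [|a s [l lP]]; first by exists [::].
  have [l' l'P] := supported_ex a; exists (l' ++ l) => b.
  rewrite inE => /predU1P[->|/lP bl] k kU kS; [apply: l'P|apply: bl] => // z zl;
    by apply: kS; rewrite mem_cat zl ?orbT.
exists (vsum (undup l)); split.
  rewrite {2}/vsum (big_morph (lpa_mul _) (mulDr _) (mulr0 _)).
  by apply: eq_big_seq => v vl; rewrite vsum_vtx// undup_uniq.
by move=> a /lP; apply; [exact: undup_uniq|move=> z; rewrite mem_undup].
Qed.

HB.instance Definition _ := Lmodule_isLocallyUnitalAlgebra.Build F lpa
  mulA mulDl mulDr mulZl mulZr lpa_local_unit.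

Lemma lpa_piM x y : lpa_pi (LMul x y) = lpa_pi x ** lpa_pi y.
Proof. by rewrite -mulE. Qed.

Definition lpa_vertex_elt (v : vertex G) : lpa := lpa_pi (LVertex v).
Definition lpa_arrow_elt (e : arrow G) : lpa := lpa_pi (LArrow e).
Definition lpa_ghost_elt (e : arrow G) : lpa := lpa_pi (LGhost e).

(* [homogeneous n] is the degree n component: the smallest family of subspaces
   that contains the generators in their degrees and is multiplicative. *)
Inductive homogeneous : int -> lpa -> Prop :=
| homogeneous_vertex v : homogeneous 0 (lpa_vertex_elt v)
| homogeneous_arrow e : homogeneous 1 (lpa_arrow_elt e)
| homogeneous_ghost e : homogeneous (- 1) (lpa_ghost_elt e)
| homogeneous0 n : homogeneous n 0
| homogeneousD n a b :
    homogeneous n a -> homogeneous n b -> homogeneous n (a + b)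
| homogeneousZ n k a : homogeneous n a -> homogeneous n (k *: a)
| homogeneousM m n a b :
    homogeneous m a -> homogeneous n b -> homogeneous (m + n) (a ** b).

(* J is the sum of its intersections with the homogeneous components. *)
Definition graded_ideal (J : ideal lpa) : Prop :=
  forall a, J a -> exists s : seq (int * lpa),
    (forall p, p \in s -> homogeneous p.1 p.2 /\ J p.2) /\
    a = \sum_(p <- s) p.2.

End LeavittPathAlgebra.

Arguments closed_submonoid {F A} S.
Arguments phi {F A} J p.
Arguments psi {F A} X.
Arguments ideal_le {F A} I J.
Arguments vsubset {F A} X Y.
Arguments graded_ideal {F G} J.

(* Main.v *)
Require Import Defs.
From HB Require Import structures.
From mathcomp Require Import all_boot all_order all_algebra.
From mathcomp Require Import finmap zify.
From mathcomp Require Import all_classical.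

Set Implicit Arguments.
Unset Strict Implicit.
Unset Printing Implicit Defensive.

Import Order.TTheory GRing.Theory Num.Theory.
Local Open Scope ring_scope.

(* A finitely generated projective P is the image of an idempotent matrix e, and
   P is orthogonal to J iff the entries of e lie in J, i.e. iff J contains the
   trace ideal of P.  So psi X is the sum of the trace ideals of the members of
   X, and phi (psi S) = S for closed S: if the trace ideal of P lies in psi S,
   then P is covered by the images of finitely many maps from members of S, and
   the resulting epimorphism onto P splits.

   Trace ideals are graded in any Z-graded algebra: modulo the trace ideal I,
   the image of e under the coaction a_n |-> a_n z ^ n is an idempotent matrix
   of Laurent polynomials that vanishes at z = 1.  Being equal to its powers, it
   is divisible by all powers of z - 1, so it is 0, and the homogeneous
   components of the entries of e lie in I.

   Conversely a homogeneous element a of a Leavitt path algebra lies in the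
   ideal generated by the idempotents of the ideal (a): let v be a vertex with
   a = a v, let s be the set of arrows e from v such that e^* occurs at the end of a
   monomial of a, and w := v - \sum_(e in s) e e^*.  Then a = a w + \sum_e
   (a e) e^*, where a e involves shorter ghost paths, and a w = c w for a
   combination c of paths of equal length, so that either c w = 0 or w is a
   multiple of some p^* c w. *)

(** * Modules over an algebra with local units *)

Section LocalUnits.
Context (F : fieldType) (A : luAlgType F).

Lemma lumul_suml I (r : seq I) (P : pred I) (f : I -> A) (a : A) :
  (\sum_(i <- r | P i) f i) ** a = \sum_(i <- r | P i) f i ** a.
Proof.
exact: (big_morph (lumul^~ a) (fun x y => lumulDl x y a) (lu0mul a)).
Qed.

Lemma lumul_sumr I (r : seq I) (P : pred I) (f : I -> A) (a : A) :
  a ** (\sum_(i <- r | P i) f i) = \sum_(i <- r | P i) a ** f i.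
Proof. exact: (big_morph (lumul a) (lumulDr a) (lumul0 a)). Qed.

Lemma lumulNr (a b : A) : a ** (- b) = - (a ** b).
Proof. by rewrite -scaleN1r lumulZr scaleN1r. Qed.

Lemma lumulNl (a b : A) : (- a) ** b = - (a ** b).
Proof. by rewrite -scaleN1r lumulZl scaleN1r. Qed.

Lemma lumulBr (a b c : A) : a ** (b - c) = a ** b - a ** c.
Proof. by rewrite lumulDr lumulNr. Qed.

Context (M : rmodType A).

Lemma ract_suml I (r : seq I) (P : pred I) (f : I -> M) (a : A) :
  (\sum_(i <- r | P i) f i) |> a = \sum_(i <- r | P i) f i |> a.
Proof. exact: (big_morph (ract^~ a) (fun x y => ractDl x y a) (r0act _ a)). Qed.

(** Unitality writes each [m] as a sum of terms [n |> a]; a local unit for the finitely many [a]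
    that occur fixes [m]. *)
Lemma ract_local_unit (s : seq M) :
  exists u : A, forall m, m \in s -> m |> u = m.
Proof.
suff [l lP] : exists l : seq A, forall u, (forall a, a \in l -> a ** u = a) ->
    forall m, m \in s -> m |> u = m.
  by have [u [_ uP]] := local_unit l; exists u; apply: lP => a /uP[].
elim: s => [|m s [l lP]]; first by exists [::].
have [t mE] := ract_unital m; exists (map snd t ++ l) => u uP n.
rewrite inE => /predU1P[->|]; last first.
  by apply: lP => a al; apply: uP; rewrite mem_cat al orbT.
rewrite mE ract_suml; apply: eq_big_seq => p pt.
by rewrite -ractA uP// mem_cat map_f.
Qed.

End LocalUnits.

Section RegularModule.
Context (F : fieldType) (A : luAlgType F).

Definition regular_module : Type := A.

HB.instance Definition _ := GRing.Lmodule.on regular_module.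

Let act_unital (m : A) : exists s : seq (A * A),
  m = \sum_(p <- s) p.1 ** p.2.
Proof.
have [u [_ /(_ m)]] := local_unit [:: m].
by rewrite mem_head => /(_ isT)[_ mu]; exists [:: (m, u)]; rewrite big_seq1.
Qed.

HB.instance Definition _ := Lmodule_isRModule.Build F A regular_module
  (@lumulA _ A) (@lumulDl _ A) (@lumulDr _ A) (@lumulZl _ A)
  (fun k m a => @lumulZr _ A k m a) act_unital.

Lemma quot_proj_rhom (J : ideal A) :
  @is_rhom F A regular_module (quot_module J) (@quot_proj F A J).
Proof.
by split=> [k x y|m a]; [rewrite quot_projD quot_projZ|rewrite -quot_projM].
Qed.

Lemma quot_proj_eq0 (J : ideal A) x : quot_proj J x = 0 <-> J x.
Proof. by rewrite -(rhom0 (quot_proj_rhom J)) quot_projP subr0. Qed.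

End RegularModule.

Section FiniteProduct.
Context (F : fieldType) (A : luAlgType F) (M : rmodType A) (I : finType).
Local Notation MI := {ffun I -> M}.

Let act (m : MI) (a : A) : MI := [ffun i => m i |> a].

Let actA m a b : act m (a ** b) = act (act m a) b.
Proof. by apply/ffunP => i; rewrite !ffunE ractA. Qed.

Let actDl m n a : act (m + n) a = act m a + act n a.
Proof. by apply/ffunP => i; rewrite !ffunE ractDl. Qed.

Let actDr m a b : act m (a + b) = act m a + act m b.
Proof. by apply/ffunP => i; rewrite !ffunE ractDr. Qed.

Let actZl (k : F) m a : act (k *: m) a = k *: act m a.
Proof. by apply/ffunP => i; rewrite !ffunE ractZl. Qed.

Let actZr (k : F) m a : act m (k *: a) = k *: act m a.
Proof. by apply/ffunP => i; rewrite !ffunE ractZr. Qed.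

Let act_unital m : exists s : seq (MI * A), m = \sum_(p <- s) act p.1 p.2.
Proof.
have [u uP] := ract_local_unit [seq m i | i : I].
exists [:: (m, u)]; rewrite big_seq1; apply/ffunP => i.
by rewrite ffunE uP// map_f// mem_enum.
Qed.

HB.instance Definition _ := Lmodule_isRModule.Build F A MI
  actA actDl actDr actZl actZr act_unital.

Lemma ffun_ractE (m : MI) (a : A) i : (m |> a) i = m i |> a.
Proof. by rewrite ffunE. Qed.

End FiniteProduct.

Section FixedSubmodule.
Context (F : fieldType) (A : luAlgType F) (M : rmodType A) (p : M -> M).
Hypothesis ph : is_rhom p.

(** The proof is an argument so that the closure instance, which depends on it, can be inferred from
    the predicate. In use [p] is idempotent and the fixed module is its image. *)
Definition fixed_pred of is_rhom p : {pred M} := [pred x | p x == x].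

Let fixed_submod_closed : GRing.submod_closed (fixed_pred ph).
Proof.
split=> [|k x y /eqP xE /eqP yE]; apply/eqP; first exact: rhom0.
by rewrite ph.1 xE yE.
Qed.

HB.instance Definition _ :=
  GRing.isSubmodClosed.Build F M (fixed_pred ph) fixed_submod_closed.

Record fixed_module :=
  Fixed { fixed_val : M; fixed_valP : fixed_val \in fixed_pred ph }.

HB.instance Definition _ := [isSub for fixed_val].
HB.instance Definition _ := [Choice of fixed_module by <:].
HB.instance Definition _ := [SubChoice_isSubLmodule of fixed_module by <:].

Lemma fixedE (x : fixed_module) : p (val x) = val x.
Proof. exact/eqP/(valP x). Qed.

Lemma fixed_ract_subproof (m : fixed_module) (a : A) :
  val m |> a \in fixed_pred ph.
Proof. by apply/eqP; rewrite ph.2 fixedE. Qed.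

Let act m a : fixed_module := Sub (val m |> a) (fixed_ract_subproof m a).

Let actA m a b : act m (a ** b) = act (act m a) b.
Proof. by apply/val_inj; rewrite /= ractA. Qed.

Let actDl m n a : act (m + n) a = act m a + act n a.
Proof. by apply/val_inj; rewrite /= ractDl. Qed.

Let actDr m a b : act m (a + b) = act m a + act m b.
Proof. by apply/val_inj; rewrite /= ractDr. Qed.

Let actZl (k : F) m a : act (k *: m) a = k *: act m a.
Proof. by apply/val_inj; rewrite /= ractZl. Qed.

Let actZr (k : F) m a : act m (k *: a) = k *: act m a.
Proof. by apply/val_inj; rewrite /= ractZr. Qed.

Let act_unital m : exists s : seq (fixed_module * A),
  m = \sum_(p <- s) act p.1 p.2.
Proof.
have [u uP] := ract_local_unit [:: val m].
exists [:: (m, u)]; rewrite big_seq1; apply/val_inj => /=.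
by rewrite uP ?mem_head.
Qed.

HB.instance Definition _ := Lmodule_isRModule.Build F A fixed_module
  actA actDl actDr actZl actZr act_unital.

Lemma fixed_val_rhom : @is_rhom F A fixed_module M val.
Proof. by split. Qed.

Lemma fixed_corestr (N : rmodType A) (f : N -> M) : is_rhom f ->
  (forall x, p (f x) = f x) ->
  exists g : N -> fixed_module, is_rhom g /\ forall x, val (g x) = f x.
Proof.
move=> fh pf; have fP x : f x \in fixed_pred ph by apply/eqP.
exists (fun x => Sub (f x) (fP x)); split; last by move=> x; rewrite SubK.
by split=> [k x y|m a]; apply: val_inj; rewrite /= ?fh.1 ?fh.2.
Qed.

End FixedSubmodule.

(** * Dual bases, trace ideals and orthogonality *)

Section FgProjective.
Context (F : fieldType) (A : luAlgType F).

Lemma rhom_sum (M N : rmodType A) (f : M -> N) (fh : is_rhom f)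
    I (r : seq I) (g : I -> M) :
  f (\sum_(i <- r) g i) = \sum_(i <- r) f (g i).
Proof. exact: (big_morph f (rhomD fh) (rhom0 fh)). Qed.

Lemma rhomD_rhom (M N : rmodType A) (f g : M -> N) :
  is_rhom f -> is_rhom g -> is_rhom (fun x => f x + g x).
Proof.
move=> fh gh; split=> [k x y|m a]; last by rewrite fh.2 gh.2 ractDl.
by rewrite fh.1 gh.1 scalerDr addrACA.
Qed.

Lemma rhom0_rhom (M N : rmodType A) : is_rhom (fun _ : M => 0 : N).
Proof. by split=> [k x y|m a]; rewrite ?scaler0 ?addr0 ?r0act. Qed.

Lemma ract_rhom (M : rmodType A) (m : M) :
  @is_rhom F A (regular_module A) M (ract m).
Proof. by split=> [k a b|a b]; [rewrite ractDr ractZr|rewrite -ractA]. Qed.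

Lemma projective_retract (P Q : rmodType A) (i : Q -> P) (r : P -> Q) :
  is_rhom i -> is_rhom r -> (forall x, r (i x) = x) ->
  projective P -> projective Q.
Proof.
move=> ih rh ri projP M N g f gh gs fh.
have [h [hh hE]] := projP M N g _ gh gs (rhom_comp rh fh).
exists (h \o i); split; first exact: rhom_comp.
by move=> x; rewrite /= hE /= ri.
Qed.

Lemma fg_image (P Q : rmodType A) (r : P -> Q) : is_rhom r ->
  (forall y, exists x, r x = y) -> finitely_generated P -> finitely_generated Q.
Proof.
move=> rh rs [n [g gP]]; exists n, (r \o g) => y; have [x <-] := rs y.
have [a {1}->] := gP x; exists a; rewrite (rhom_sum rh).
by apply: eq_bigr => i _; rewrite rh.2.
Qed.

(** The map [s] from A^n onto [P] given by generators splits because [P] is projective; the [h i]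
    are the coordinates of a section. *)
Lemma dual_basis (P : fgproj A) :
  exists (n : nat) (g : 'I_n -> P) (h : 'I_n -> P -> regular_module A),
    (forall i, is_rhom (h i)) /\ forall x, x = \sum_i g i |> h i x.
Proof.
have [n [g gP]] := fgproj_fg P; exists n, g.
pose s (a : {ffun 'I_n -> regular_module A}) : P := \sum_i g i |> a i.
have sh : is_rhom s.
  split=> [k x y|m a]; rewrite /s.
    rewrite scaler_sumr -big_split; apply: eq_bigr => i _ /=.
    by rewrite !ffunE ractDr ractZr.
  rewrite ract_suml; apply: eq_bigr => i _.
  by rewrite ffun_ractE ractA.
have ss y : exists x, s x = y.
  have [a ->] := gP y; exists [ffun i => a i].
  by apply: eq_bigr => i _; rewrite ffunE.
have idh : is_rhom (@id P) by [].
have [h [hh hE]] := fgproj_proj sh ss idh.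
exists (fun i x => h x i); split=> [i|x]; last by rewrite -[LHS]hE.
by split=> [k x y|m a]; rewrite ?hh.1 ?hh.2 ?ffun_ractE ?ffunE.
Qed.

(* P is the image of the matrix e, whose entries generate its trace ideal. *)
Lemma perp_matrix (P : fgproj A) : exists (n : nat) (e : 'I_n -> 'I_n -> A),
  (forall i j, e i j = \sum_k e i k ** e k j) /\
  forall J : ideal A, perp P J <-> forall i j, J (e i j).
Proof.
have [n [g [h [hh hE]]]] := dual_basis P; exists n, (fun i j => h i (g j)).
have eE i x : h i x = \sum_k (h i (g k) : A) ** h k x.
  rewrite {1}[x]hE (rhom_sum (hh i)).
  by apply: eq_bigr => k _; rewrite (hh i).2.
split=> [i j|J]; first exact: eE.
have [J0 JD JZ JMl JMr] := ideal_axiom J; split=> [PJ i j|eJ f fh x].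
  exact/quot_proj_eq0/(PJ _ (rhom_comp (hh i) (quot_proj_rhom J)) (g j)).
have hJ i : J (h i x).
  by rewrite eE; apply: big_ind => // k _; exact: JMr.
rewrite [x]hE (rhom_sum fh) big1// => i _; rewrite fh.2.
have [y ->] := quot_proj_surj (f (g i)); rewrite -quot_projM.
exact/quot_proj_eq0/JMl.
Qed.

(** By [perp_matrix], orthogonality only asks that certain elements lie in the ideal. *)
Lemma perp_le (P : fgproj A) (I J : ideal A) :
  ideal_le I J -> perp P I -> perp P J.
Proof.
move=> IJ; have [n [e [_ eP]]] := perp_matrix P.
by move=> /eP eI; apply/eP => i j; exact: IJ.
Qed.

Lemma perp_retract (P Q : fgproj A) (r : P -> Q) (J : ideal A) : is_rhom r ->
  (forall y, exists x, r x = y) -> perp P J -> perp Q J.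
Proof.
move=> rh rs PJ f fh y; have [x <-] := rs y.
exact: PJ (rhom_comp rh fh) x.
Qed.

Lemma perp_iso (P Q : fgproj A) (J : ideal A) :
  isomorphic P Q -> perp P J -> perp Q J.
Proof.
move=> [f [fh [f' _ f'K]]]; apply: perp_retract fh _ => y.
by exists (f' y).
Qed.

Lemma phi_iso_class (P : fgproj A) (J : ideal A) :
  phi J (iso_class P) <-> perp P J.
Proof.
split=> [[Q [/esym/iso_classP QP QJ]]|]; last by exists P.
exact: perp_iso QP QJ.
Qed.

(** The module is the right ideal uA, generated by [u], and its trace ideal is the ideal generated
    by [u]. *)
Lemma idempotent_fgproj (u : A) : u ** u = u ->
  exists P : fgproj A, forall J : ideal A, perp P J <-> J u.
Proof.
move=> uu; have uh := ract_rhom (u : regular_module A).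
pose P : rmodType A := fixed_module uh.
have uP : (u : regular_module A) \in fixed_pred uh by apply/eqP.
pose w : P := Fixed uP.
have uE (x : P) : x = w |> (fixed_val x : A).
  by apply: val_inj; rewrite /= -[LHS](fixedE x).
have fgP : finitely_generated P.
  exists 1%N, (fun=> w) => x; exists (fun=> fixed_val x).
  by rewrite big_ord1 -uE.
have projP : projective P.
  (* A homomorphism on uA is determined by the image of [w], so any preimage [m] of [f w] gives a
     lift x |-> m x. *)
  move=> M N g f gh gs fh; have [m mE] := gs (f w).
  exists (ract m \o (@fixed_val _ _ _ _ uh : P -> A)); split.
    exact: rhom_comp (fixed_val_rhom uh) (ract_rhom m).
  by move=> x; rewrite /= gh.2 mE -fh.2 -uE.
exists (Fgproj fgP projP) => J; split=> [PJ|Ju f fh x] /=.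
  apply/quot_proj_eq0.
  exact: (PJ _ (rhom_comp (fixed_val_rhom uh) (quot_proj_rhom J)) w).
(* Since [w = w |> u], the value [f w] is the class of some [y ** u], which is zero modulo [J]. *)
have uuE : w = w |> u by apply: val_inj; rewrite /= [RHS]uu.
rewrite [x]uE fh.2 uuE fh.2.
have [y ->] := quot_proj_surj (f w); rewrite -!quot_projM.
have [_ _ _ JMl JMr] := ideal_axiom J.
exact/quot_proj_eq0/JMr/JMl.
Qed.

End FgProjective.

(** * The Galois connection *)

Section GaloisConnection.
Context (F : fieldType) (A : luAlgType F).

(** Membership of the matrix entries passes to intersections of ideals, so [psi X] is itself one of
    the ideals that it intersects, hence the least of them. *)
Lemma perp_psi (X : vmonoid A -> Prop) (P : fgproj A) :
  X (iso_class P) -> perp P (psi X).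
Proof.
move=> XP; have [n [e [_ eP]]] := perp_matrix P.
by apply/eP => i j I XI; apply: (eP I).1; exact: XI.
Qed.

Lemma phi_psi_galois (X : vmonoid A -> Prop) (J : ideal A) :
  vsubset X (phi J) <-> ideal_le (psi X) J.
Proof.
split=> [XJ a aX|XJ p Xp]; first by apply: aX => P /XJ/phi_iso_class.
have [P pE] := iso_class_surj p; rewrite pE in Xp *.
exact/phi_iso_class/(perp_le XJ)/perp_psi.
Qed.

Lemma phi_closed (J : ideal A) : closed_submonoid (phi J).
Proof.
split=> [|p q|p q].
- apply/phi_iso_class => f fh x.
  by rewrite (zero_module_eq x 0) (rhom0 fh).
- have [P ->] := iso_class_surj p; have [Q ->] := iso_class_surj q.
  move=> /phi_iso_class PJ /phi_iso_class QJ; rewrite vadd_iso_class.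
  apply/phi_iso_class => f fh [x y].
  have lh : is_rhom (fun x : P => (x, 0) : (P * Q)%type).
    split=> [k x' y'|m a]; congr pair; first by rewrite /= scaler0 addr0.
    by rewrite /= r0act.
  have rh : is_rhom (fun y : Q => (0, y) : (P * Q)%type).
    split=> [k x' y'|m a]; congr pair; first by rewrite /= scaler0 addr0.
    by rewrite /= r0act.
  have -> : (x, y) = ((x, 0) : (P * Q)%type) + (0, y).
    by congr pair; rewrite /= ?addr0 ?add0r.
  rewrite (rhomD fh) [X in X + _](PJ _ (rhom_comp lh fh) x).
  by rewrite [X in _ + X](QJ _ (rhom_comp rh fh) y) addr0.
- move=> + [r]; have [P ->] := iso_class_surj p.
  have [Q ->] := iso_class_surj q; have [R ->] := iso_class_surj r.
  move=> /phi_iso_class PJ; rewrite vadd_iso_class => /iso_classP PQR.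
  apply/phi_iso_class; apply: (@perp_retract _ _ (fgproj_sum Q R) Q fst).
  + by split.
  + by move=> y; exists (y, 0).
  + exact: perp_iso PQR PJ.
Qed.

(* The kernel of an epimorphism [Q -> P] is the complement of the image of a
   section [s] of it, i.e. the fixed module of the idempotent [1 - s f]. *)
Lemma epi_class_surj (P Q : fgproj A) (f : Q -> P) : is_rhom f ->
  (forall y, exists x, f x = y) -> epi_class (iso_class Q) (iso_class P).
Proof.
move=> fh fs; have idh : is_rhom (@id P) by [].
have [s [sh sK]] := fgproj_proj fh fs idh.
pose p (x : Q) : Q := x - s (f x).
have ph : is_rhom p.
  split=> [k x y|m a]; rewrite /p.
    by rewrite fh.1 sh.1 scalerBr opprD addrACA.
  by rewrite fh.2 sh.2 ractDl -[X in _ + X]scaleN1r -ractZl scaleN1r.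
have fp x : f (p x) = 0.
  by rewrite (rhomD fh) -scaleN1r (rhomZ fh) sK scaleN1r subrr.
have pp x : p (p x) = p x by rewrite /p -/(p x) fp (rhom0 sh) subr0.
pose R : rmodType A := fixed_module ph.
have [r [rh rE]] := fixed_corestr ph ph pp.
have rK (x : R) : r (fixed_val x) = x by apply: val_inj; rewrite rE fixedE.
have fgR : finitely_generated R.
  by apply: (fg_image rh _ (fgproj_fg Q)) => y; exists (fixed_val y).
have projR : projective R.
  exact: projective_retract (fixed_val_rhom ph) rh rK (fgproj_proj (f := Q)).
exists (iso_class (Fgproj fgR projR)); rewrite vadd_iso_class.
apply/iso_classP; exists (fun x => (f x, r x)); split.
  by split=> [k x y|m a]; rewrite ?fh.1 ?rh.1 ?fh.2 ?rh.2.
exists (fun x : P * R => s x.1 + fixed_val x.2) => [x|[x y]] /=.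
  by rewrite [fixed_val _]rE /p addrC subrK.
have fy : f (fixed_val y) = 0 by rewrite -(fixedE y) fp.
have rs : r (s x) = 0 by apply: val_inj; rewrite rE /p sK subrr.
by rewrite (rhomD fh) (rhomD rh) sK fy rs rK addr0 add0r.
Qed.

(** * The trace of a closed submonoid in a module *)

Section TraceIn.
Variables (S : vmonoid A -> Prop) (M : rmodType A).
Hypothesis Scl : closed_submonoid S.

Definition reached (m : M) : Prop := exists (Q : fgproj A) (f : Q -> M),
  [/\ S (iso_class Q), is_rhom f & exists x, f x = m].

(** The direct sum of the modules that reach the single elements is again in [S], and the sum of
    their maps reaches all of them. *)
Lemma reached_sum n (g : 'I_n -> M) : (forall i, reached (g i)) ->
  exists (Q : fgproj A) (f : Q -> M),
    [/\ S (iso_class Q), is_rhom f & forall i, exists x, f x = g i].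
Proof.
have [S0 SD _] := Scl; elim: n g => [|n IHn] g gP.
  exists (fgproj_zero A), (fun=> 0); split=> // [|[]//].
  exact: rhom0_rhom.
have [Q [f [SQ fh fP]]] := IHn _ (fun i => gP (lift ord0 i)).
have [R [f' [SR fh' [x xP]]]] := gP ord0.
exists (fgproj_sum R Q), (fun p => f' p.1 + f p.2); split.
- by rewrite -vadd_iso_class; exact: SD.
- apply: rhomD_rhom; first by apply: (rhom_comp _ fh'); split.
  by apply: (rhom_comp _ fh); split.
move=> i; have [j ->|->] := unliftP ord0 i.
  by have [y yP] := fP j; exists (0, y); rewrite /= (rhom0 fh') add0r.
by exists (x, 0); rewrite /= (rhom0 fh) addr0.
Qed.

(** The reached elements form the trace of [S] in [M], and this is the annihilator of [M] modulo
    that trace. It serves as an ideal orthogonal to all members of [S], which therefore contains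
    [psi S]. *)
Definition reached_set (a : A) : Prop := forall m : M, reached (m |> a).

Lemma reached_ideal : is_ideal reached_set.
Proof.
have reachedD m m' : reached m -> reached m' -> reached (m + m').
  move=> rm rm'; have g2 (i : 'I_2) : reached (if i == 0 then m else m').
    by case: ifP.
  have [Q [f [SQ fh fP]]] := reached_sum g2; exists Q, f; split=> //.
  have [x xP] := fP 0; have [y yP] := fP 1.
  by exists (x + y); rewrite (rhomD fh) xP yP.
split=> [m|a b ra rb m|k a ra m|a b rb m|a b rb m].
- have [S0 _ _] := Scl; exists (fgproj_zero A), (fun=> 0).
  by split=> //; [exact: rhom0_rhom|exists 0; rewrite ract0].
- by rewrite ractDr; exact: reachedD.
- have [Q [f [SQ fh [x xP]]]] := ra m; exists Q, f; split=> //.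
  by exists (k *: x); rewrite (rhomZ fh) xP ractZr.
- by rewrite ractA; exact: rb.
- have [Q [f [SQ fh [x xP]]]] := rb m; exists Q, f; split=> //.
  by exists (x |> a); rewrite fh.2 xP ractA.
Qed.

(** For every [m] the map x |-> m |> h i x is a homomorphism from [Q] to [M], so the coordinates
    [h i] take their values in [reached_set]. *)
Lemma perp_reached (Q : fgproj A) :
  S (iso_class Q) -> perp Q (Ideal reached_ideal).
Proof.
move=> SQ; have [n [g [h [hh hE]]]] := dual_basis Q.
have [J0 JD JZ JMl JMr] := reached_ideal.
have hJ i x : reached_set (h i x).
  move=> m; exists Q, (ract m \o h i); split=> //; last by exists x.
  exact: rhom_comp (hh i) (ract_rhom m).
move=> f fh x; rewrite [x]hE (rhom_sum fh) big1// => i _; rewrite fh.2.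
have [y ->] := quot_proj_surj (f (g i)); rewrite -quot_projM.
exact/quot_proj_eq0/JMl/hJ.
Qed.

End TraceIn.

Lemma phi_psi_closed (S : vmonoid A -> Prop) :
  closed_submonoid S -> phi (psi S) = S.
Proof.
move=> Scl; apply: functional_extensionality_dep => p; apply/propext.
split=> [|Sp]; last exact: (phi_psi_galois S (psi S)).2 _ p Sp.
have [P ->] := iso_class_surj p => /phi_iso_class PS.
have [n [g [h [hh hE]]]] := dual_basis P.
(* The trace is taken in [P] itself. As [T] contains [psi S], the trace ideal of [P] lies in [T]. *)
pose T := Ideal (reached_ideal P Scl).
have PT : perp P T.
  apply: perp_le PS => a aS; apply: aS => Q; exact: perp_reached.
have hT i x : T (h i x).
  apply/quot_proj_eq0.
  exact: (PT _ (rhom_comp (hh i) (quot_proj_rhom T)) x).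
(* By the dual basis this sum is [g i]; its summands are reached because [h j (g i)] is in [T]. *)
have gh i : reached S (\sum_j g j |> h j (g i)).
  have [Q [f [SQ fh fP]]] := reached_sum Scl (fun j => hT j (g i) (g j)).
  exists Q, f; split=> //; have [x xP] := choice fP.
  by exists (\sum_j x j); rewrite (rhom_sum fh); apply: eq_bigr => j _.
(* A single member [Q] of [S] now hits all generators, so [f] is onto and makes [P] a direct summand
   of [Q]. *)
have [Q [f [SQ fh fP]]] := reached_sum Scl gh.
have [_ _ Sepi] := Scl; apply: Sepi SQ _; apply: (epi_class_surj fh) => y.
have {}fP i : exists x, f x = g i by have [x] := fP i; rewrite -hE; exists x.
have [x xP] := choice fP.
exists (\sum_i x i |> h i y); rewrite (rhom_sum fh) [RHS]hE.
by apply: eq_bigr => i _; rewrite fh.2 xP.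
Qed.

End GaloisConnection.

(** * Trace ideals are graded *)

Section Grading.
Context (F : fieldType) (G : digraph).
Local Notation A := (lpa F G).
Local Notation vtx := (@lpa_vertex_elt F G).
Local Notation arr := (@lpa_arrow_elt F G).
Local Notation gst := (@lpa_ghost_elt F G).

Lemma vertexM u v : vtx u ** vtx v = if u == v then vtx u else 0.
Proof. by rewrite -lpa_piM; case: eqP (lpa_vertex F u v) => _ /lpa_piP. Qed.

Lemma src_arrow e : vtx (src e) ** arr e = arr e.
Proof. by rewrite -lpa_piM; exact/lpa_piP/lpa_src_arrow. Qed.

Lemma arrow_tgt e : arr e ** vtx (tgt e) = arr e.
Proof. by rewrite -lpa_piM; exact/lpa_piP/lpa_arrow_tgt. Qed.

Lemma tgt_ghost e : vtx (tgt e) ** gst e = gst e.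
Proof. by rewrite -lpa_piM; exact/lpa_piP/lpa_tgt_ghost. Qed.

Lemma ghost_src e : gst e ** vtx (src e) = gst e.
Proof. by rewrite -lpa_piM; exact/lpa_piP/lpa_ghost_src. Qed.

Lemma ghost_arrow e f : gst e ** arr f = if e == f then vtx (tgt e) else 0.
Proof. by rewrite -lpa_piM; case: eqP (lpa_ck1 F e f) => _ /lpa_piP. Qed.

Lemma lpa_pi_sum I (r : seq I) (f : I -> lpa_term F G) :
  lpa_pi (\big[@LAdd F G/LZero]_(i <- r) f i) = \sum_(i <- r) lpa_pi (f i).
Proof. exact: (big_morph (@lpa_pi F G) (@lpa_piD F G) erefl). Qed.

Lemma vertex_ck2 v : (emitted v !=set0)%classic -> finite_set (emitted v) ->
  vtx v = \sum_(e <- fset_set (emitted v)) arr e ** gst e.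
Proof.
move=> v0 vfin; have /lpa_piP := lpa_ck2 F v0 vfin; rewrite lpa_pi_sum => vE.
by rewrite [LHS]vE; apply: eq_bigr => e _; rewrite lpa_piM.
Qed.

(** With [X := J] this is the condition in [graded_ideal]; with the trivial [X] it is satisfied by
    every element. *)
Definition homogeneous_decomposition (X : A -> Prop) (a : A) : Prop :=
  exists s : seq (int * A),
    (forall p, p \in s -> homogeneous p.1 p.2 /\ X p.2) /\
    a = \sum_(p <- s) p.2.

Lemma homogeneous_decomposition1 (X : A -> Prop) n a :
  homogeneous n a -> X a -> homogeneous_decomposition X a.
Proof.
move=> an aX; exists [:: (n, a)]; rewrite big_seq1; split=> // p.
by rewrite inE => /eqP->.
Qed.

Lemma homogeneous_decompositionD (X : A -> Prop) a b :
  homogeneous_decomposition X a -> homogeneous_decomposition X b ->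
  homogeneous_decomposition X (a + b).
Proof.
move=> [s [sX ->]] [t [tX ->]]; exists (s ++ t); rewrite big_cat; split=> // p.
by rewrite mem_cat => /orP[/sX|/tX].
Qed.

Lemma homogeneous_decompositionM (X Y Z : A -> Prop) a b :
  (forall x y, X x -> Y y -> Z (x ** y)) ->
  homogeneous_decomposition X a -> homogeneous_decomposition Y b ->
  homogeneous_decomposition Z (a ** b).
Proof.
move=> XYZ [s [sX ->]] [t [tY ->]].
exists [seq (p.1 + q.1, p.2 ** q.2) | p <- s, q <- t]; split.
  move=> _ /allpairsP[[p q] /= [/sX[ph pX] /tY[qh qY] ->]] /=.
  by split; [exact: homogeneousM|exact: XYZ].
rewrite big_allpairs_dep lumul_suml; apply: eq_bigr => p _.
by rewrite lumul_sumr.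
Qed.

Lemma homogeneous_decompositionZ (X : A -> Prop) k a :
  (forall x, X x -> X (k *: x)) ->
  homogeneous_decomposition X a -> homogeneous_decomposition X (k *: a).
Proof.
move=> XZ [s [sX ->]]; exists [seq (p.1, k *: p.2) | p <- s].
split=> [_ /mapP[p /sX[ph pX] ->]|]; last by rewrite scaler_sumr big_map.
by split; [exact: homogeneousZ|exact: XZ].
Qed.

Lemma homogeneous_decomposition_ex a : homogeneous_decomposition (fun=> True) a.
Proof.
have [x {a}->] := lpa_pi_surj a.
elim: x => [v|e|e||x IHx|x IHx y IHy|k x IHx|x IHx y IHy].
- exact: homogeneous_decomposition1 (homogeneous_vertex F v) I.
- exact: homogeneous_decomposition1 (homogeneous_arrow F e) I.
- exact: homogeneous_decomposition1 (homogeneous_ghost F e) I.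
- by exists [::]; rewrite big_nil.
- by rewrite lpa_piN -scaleN1r; exact: homogeneous_decompositionZ.
- by rewrite lpa_piD; exact: homogeneous_decompositionD.
- by rewrite lpa_piZ; exact: homogeneous_decompositionZ.
- by rewrite lpa_piM; exact: homogeneous_decompositionM IHx IHy.
Qed.

(* The coaction [a_n |-> a_n z ^ n] of the grading, with [w : int -> A] read as
   the formal Laurent series [\sum_n w n z ^ n]. *)
Fixpoint term_coact (x : lpa_term F G) (w : int -> A) : int -> A :=
  match x with
  | LVertex v => fun n => vtx v ** w n
  | LArrow e => fun n => arr e ** w (n - 1)
  | LGhost e => fun n => gst e ** w (n + 1)
  | LZero => fun=> 0
  | LOpp x => fun n => - term_coact x w n
  | LAdd x y => fun n => term_coact x w n + term_coact y w n
  | LScale k x => fun n => k *: term_coact x w n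
  | LMul x y => term_coact x (term_coact y w)
  end.

Lemma term_coact_ext x w w' : w =1 w' -> term_coact x w =1 term_coact x w'.
Proof.
elim: x w w' => [v|e|e||x IHx|x IHx y IHy|k x IHx|x IHx y IHy] w w' ww n //=.
- by rewrite ww.
- by rewrite ww.
- by rewrite ww.
- by rewrite (IHx _ _ ww).
- by rewrite (IHx _ _ ww) (IHy _ _ ww).
- by rewrite (IHx _ _ ww).
- by apply: IHx; exact: IHy.
Qed.

Lemma term_coactDZ x k w w' n :
  term_coact x (fun m => k *: w m + w' m) n =
  k *: term_coact x w n + term_coact x w' n.
Proof.
elim: x w w' n => [v|e|e||x IHx|x IHx y IHy|l x IHx|x IHx y IHy] w w' n /=.
- by rewrite lumulDr lumulZr.
- by rewrite lumulDr lumulZr.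
- by rewrite lumulDr lumulZr.
- by rewrite scaler0 addr0.
- by rewrite IHx opprD scalerN.
- by rewrite IHx IHy scalerDr addrACA.
- by rewrite IHx scalerDr !scalerA mulrC.
- by rewrite -IHx; apply: term_coact_ext => m; exact: IHy.
Qed.

Lemma term_coactD x w w' n :
  term_coact x (fun m => w m + w' m) n = term_coact x w n + term_coact x w' n.
Proof.
rewrite -[term_coact x w n]scale1r -term_coactDZ.
by apply: term_coact_ext => m; rewrite scale1r.
Qed.

Lemma term_coactZ x k w n :
  term_coact x (fun m => k *: w m) n = k *: term_coact x w n.
Proof.
have E : term_coact x (fun=> 0) n = 0.
  apply: (addrI (term_coact x (fun=> 0) n)); rewrite addr0 -term_coactD.
  by apply: term_coact_ext => m; rewrite addr0.
rewrite -[RHS]addr0 -E -term_coactDZ.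
by apply: term_coact_ext => m; rewrite addr0.
Qed.

Lemma term_coact_sum I (r : seq I) (f : I -> lpa_term F G) w n :
  term_coact (\big[@LAdd F G/LZero]_(i <- r) f i) w n =
  \sum_(i <- r) term_coact (f i) w n.
Proof. exact: (big_morph (fun x => term_coact x w n) (fun _ _ => erefl)). Qed.

(** The defining relations are homogeneous, so both sides shift exponents equally; hence the
    coaction descends from terms to A. *)
Lemma term_coact_eq x y :
  lpa_eq x y -> forall w, term_coact x w =1 term_coact y w.
Proof.
elim=> {x y} /=.
- by [].
- by move=> x y _ IH w n; rewrite IH.
- by move=> x y z _ IH _ IH' w n; rewrite IH IH'.
- by move=> x x' _ IH w n; rewrite IH.
- by move=> x x' y y' _ IH _ IH' w n; rewrite IH IH'.
- by move=> k x x' _ IH w n; rewrite IH.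
- move=> x x' y y' _ IH _ IH' w n; rewrite IH.
  by apply: term_coact_ext; exact: IH'.
- by move=> x y z w n; rewrite addrA.
- by move=> x y w n; rewrite addrC.
- by move=> x w n; rewrite add0r.
- by move=> x w n; rewrite addNr.
- by move=> k l x w n; rewrite scalerA.
- by move=> x w n; rewrite scale1r.
- by move=> k x y w n; rewrite scalerDr.
- by move=> k l x w n; rewrite scalerDl.
- by [].
- by [].
- by move=> x y z w n; rewrite term_coactD.
- by [].
- by move=> k x y w n; rewrite term_coactZ.
- by move=> u v w n; rewrite lumulA vertexM; case: eqP => //= _; rewrite lu0mul.
- by move=> e w n; rewrite lumulA src_arrow.
- by move=> e w n; rewrite lumulA arrow_tgt.
- by move=> e w n; rewrite lumulA tgt_ghost.
- by move=> e w n; rewrite lumulA ghost_src.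
- move=> e f w n; rewrite addrK lumulA ghost_arrow.
  by case: eqP => //= _; rewrite lu0mul.
- move=> v v0 vfin w n; rewrite term_coact_sum (vertex_ck2 v0 vfin) lumul_suml.
  by apply: eq_bigr => e _; rewrite /= subrK lumulA.
Qed.

Definition coact (a : A) : (int -> A) -> int -> A := term_coact (repr a).

Lemma coact_pi x w n : coact (lpa_pi x) w n = term_coact x w n.
Proof. exact: (term_coact_eq (lpa_reprK x)). Qed.

Lemma coactM a b w n : coact (a ** b) w n = coact a (coact b w) n.
Proof.
have [x ->] := lpa_pi_surj a; have [y ->] := lpa_pi_surj b.
rewrite -lpa_piM !coact_pi /=; apply: term_coact_ext => m.
by rewrite coact_pi.
Qed.

Lemma coactD a b w n : coact (a + b) w n = coact a w n + coact b w n.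
Proof.
have [x ->] := lpa_pi_surj a; have [y ->] := lpa_pi_surj b.
by rewrite -lpa_piD !coact_pi.
Qed.

Lemma coact0 w n : coact 0 w n = 0.
Proof. exact: (coact_pi LZero). Qed.

Lemma coactZ k a w n : coact (k *: a) w n = k *: coact a w n.
Proof. by have [x ->] := lpa_pi_surj a; rewrite -lpa_piZ !coact_pi. Qed.

Lemma coact_sum I (r : seq I) (f : I -> A) w n :
  coact (\sum_(i <- r) f i) w n = \sum_(i <- r) coact (f i) w n.
Proof.
exact: (big_morph (fun x => coact x w n) (fun a b => coactD a b w n)
  (coact0 w n)).
Qed.

Lemma coact_homogeneous k a w n :
  homogeneous k a -> coact a w n = a ** w (n - k).
Proof.
move=> ak; elim: ak w n => {k a} [v|e|e|k|k a b _ IHa _ IHb|k l a _ IHa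
  |k l a b _ IHa _ IHb] w n.
- by rewrite coact_pi subr0.
- by rewrite coact_pi.
- by rewrite coact_pi opprK.
- by rewrite coact0 lu0mul.
- by rewrite coactD IHa IHb lumulDl.
- by rewrite coactZ IHa lumulZl.
- by rewrite coactM IHa IHb lumulA opprD addrA.
Qed.

Lemma coact_decomposition (s : seq (int * A)) w n :
  (forall p, p \in s -> homogeneous p.1 p.2) ->
  coact (\sum_(p <- s) p.2) w n = \sum_(p <- s) p.2 ** w (n - p.1).
Proof.
move=> sh; rewrite coact_sum; apply: eq_big_seq => p /sh ph.
exact: coact_homogeneous.
Qed.

(** * Laurent polynomials modulo an ideal and divisibility by powers of z - 1 *)

Section AdicFiltration.
Variable J : ideal A.
Local Notation inJ a := (a \in ideal_pred J).

Lemma ideal_predMl a b : inJ b -> inJ (a ** b).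
Proof.
by have [_ _ _ JM _] := ideal_axiom J => /ideal_predP Jb; exact/ideal_predP/JM.
Qed.

Lemma ideal_predMr a b : inJ a -> inJ (a ** b).
Proof.
by have [_ _ _ _ JM] := ideal_axiom J => /ideal_predP Ja; exact/ideal_predP/JM.
Qed.

Definition finitely_supported (f : int -> A) : Prop :=
  exists lo hi : int, forall n, (n < lo) || (hi <= n) -> inJ (f n).

(* [f] is, modulo J, a multiple of [(z - 1) ^ k] by a Laurent polynomial. *)
Fixpoint adic (k : nat) (f : int -> A) : Prop :=
  if k is k'.+1 then
    exists g, adic k' g /\ forall n, inJ (f n - (g (n - 1) - g n))
  else finitely_supported f.

Lemma adic_finitely_supported k f : adic k f -> finitely_supported f.
Proof.
elim: k f => //= k IHk f [g [/IHk[lo [hi gJ]] fg]].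
exists lo, (hi + 1) => n nP; rewrite -[f n](subrK (g (n - 1) - g n)).
by rewrite rpredD// rpredB// gJ; lia.
Qed.

Lemma adic_ext k f f' : adic k f -> (forall n, inJ (f' n - f n)) -> adic k f'.
Proof.
case: k => [[lo [hi fJ]] ff|k [g [gk fg]] ff].
  by exists lo, hi => n nP; rewrite -[f' n](subrK (f n)) rpredD ?fJ.
exists g; split=> // n; rewrite -[f' n](subrK (f n)) -addrA.
by rewrite rpredD.
Qed.

Lemma adicD k f g : adic k f -> adic k g -> adic k (fun n => f n + g n).
Proof.
elim: k f g => [f g [lo [hi fJ]] [lo' [hi' gJ]]
  |k IHk f g [f' [fk ff]] [g' [gk gg]]].
  exists (Num.min lo lo'), (Num.max hi hi') => n nP.
  by rewrite rpredD ?fJ ?gJ; lia.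
exists (fun n => f' n + g' n); split; first exact: IHk.
move=> n; have -> : f' (n - 1) + g' (n - 1) - (f' n + g' n) =
    (f' (n - 1) - f' n) + (g' (n - 1) - g' n) by rewrite opprD addrACA.
by rewrite opprD addrACA rpredD.
Qed.

Lemma adic_map k f (T : A -> A) :
  (forall a b, T (a - b) = T a - T b) -> (forall a, inJ a -> inJ (T a)) ->
  adic k f -> adic k (fun n => T (f n)).
Proof.
move=> TB TJ; elim: k f => [f [lo [hi fJ]]|k IHk f [g [gk fg]]].
  by exists lo, hi => n /fJ/TJ.
exists (fun n => T (g n)); split; first exact: IHk.
by move=> n; rewrite -!TB TJ.
Qed.

Lemma adic_shift k f (m : int) : adic k f -> adic k (fun n => f (n + m)).
Proof.
elim: k f => [f [lo [hi fJ]]|k IHk f [g [gk fg]]].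
  by exists (lo - m), (hi - m) => n nP; apply: fJ; lia.
exists (fun n => g (n + m)); split; first exact: IHk.
by move=> n; rewrite addrAC; exact: fg.
Qed.

Lemma adic_null k f : (forall n, inJ (f n)) -> adic k f.
Proof.
elim: k f => [|k IHk] f fJ; first by exists 0, 0.
exists (fun=> 0); split; first by apply: IHk => n; exact: rpred0.
by move=> n; rewrite !subr0.
Qed.

Lemma adic_sum k I (r : seq I) (f : I -> int -> A) :
  (forall i, adic k (f i)) -> adic k (fun n => \sum_(i <- r) f i n).
Proof.
move=> fk; elim: r => [|i r IHr].
  by apply: adic_null => n; rewrite big_nil rpred0.
apply: adic_ext (adicD (fk i) IHr) _ => n.
by rewrite big_cons subrr rpred0.
Qed.

Lemma adic_opp k f : adic k f -> adic k (fun n => - f n).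
Proof.
by apply: adic_map => [a b|a]; [rewrite opprB opprK addrC|rewrite rpredN].
Qed.

(* [z ^ m - 1] is a multiple of [z - 1]. *)
Lemma adic_difference k f m :
  adic k f -> adic k.+1 (fun n => f (n - m) - f n).
Proof.
suff pos f' (p : nat) : adic k f' -> adic k.+1 (fun n => f' (n - p%:Z) - f' n).
  case: m => [p fk|p fk]; first exact: pos.
  (* A negative shift is reduced to a positive one by translating [f] and changing the sign. *)
  apply: adic_ext (adic_opp (pos _ p.+1 (adic_shift p.+1 fk))) _ => n.
  by rewrite subrK opprB NegzE opprK subrr rpred0.
(* The witness is the factor 1 + z + ... + z^(p-1) of z^p - 1 times [f']; the difference
   telescopes. *)
move=> fk; exists (fun n => \sum_(0 <= i < p) f' (n - i%:Z)); split.
  by apply: adic_sum => i; exact: adic_shift.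
move=> n; rewrite [X in X - _](_ : _ =
  \sum_(0 <= i < p) (f' (n - i.+1%:Z) - f' (n - i%:Z))).
  rewrite sumrB; under [X in X - _ - _]eq_bigr do rewrite intS opprD addrA.
  by rewrite subrr rpred0.
by rewrite (telescope_sumr (fun i : nat => f' (n - i%:Z)))// subr0.
Qed.

(** Division by z - 1 shortens the window of exponents by one, so after [k] divisions a window of
    length [k] is empty. *)
Lemma adic_kill k f (lo : int) : adic k f ->
  (forall n, (n < lo) || (lo + k%:Z <= n) -> inJ (f n)) -> forall n, inJ (f n).
Proof.
elim: k f => [f _ fJ n|k IHk f [g [gk fg]] fJ n]; first by apply: fJ; lia.
suff gJ m : inJ (g m).
  by rewrite -[f n](subrK (g (n - 1) - g n)) rpredD// rpredB.
have [a [b gab]] := adic_finitely_supported gk.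
(* Where [f] vanishes modulo [J], consecutive coefficients of [g] agree. So [g] is constant on
   either side of its window, and zero there because it is finitely supported. *)
have gconst l : inJ (f l) -> inJ (g (l - 1)) = inJ (g l).
  move=> fl; have Bl : inJ (g (l - 1) - g l).
    by rewrite -[X in inJ X](subKr (f l)) rpredB.
  by rewrite -[g (l - 1)](subrK (g l)) rpredDl.
apply: IHk gk _ m => l /orP[llo|lhi].
  have down (p : nat) : inJ (g (l - p%:Z)) = inJ (g l).
    elim: p => [|p IHp]; first by rewrite subr0.
    by rewrite -IHp intS opprD addrA addrAC gconst//; apply: fJ; lia.
  by rewrite -(down (absz (l - a + 1))); apply: gab; lia.
have up (p : nat) : inJ (g (l + p%:Z)) = inJ (g l).
  elim: p => [|p IHp]; first by rewrite addr0.
  rewrite -IHp intS -[in RHS](addrK 1 (l + p%:Z)).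
  rewrite gconst -?addrA ?[p%:Z + 1]addrC//.
  by apply: fJ; lia.
by rewrite -(up (absz (b - l))); apply: gab; lia.
Qed.

(** If [a] is a sum of terms a_p of degree p, its coaction is multiplication by \sum a_p (z^p - 1)
    plus multiplication by [a], and the latter is zero modulo [J]. *)
Lemma coact_adic a k f : inJ a -> adic k f -> adic k.+1 (coact a f).
Proof.
move=> aJ fk; have [s [sh sE]] := homogeneous_decomposition_ex a.
have {}sh p : p \in s -> homogeneous p.1 p.2 by move=> /sh[].
have Dk : adic k.+1 (fun n => \sum_(p <- s) p.2 ** (f (n - p.1) - f n)).
  apply: adic_sum => p; apply: (@adic_map _ _ (lumul p.2)).
  - exact: lumulBr.
  - exact: ideal_predMl.
  - exact: adic_difference.
apply: adic_ext Dk _ => n; rewrite sE coact_decomposition// -sumrB.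
rewrite (eq_bigr (fun p => p.2 ** f n)) -?lumul_suml -?sE ?ideal_predMr//.
by move=> p _; rewrite -lumulBr opprB addrC subrK.
Qed.

Lemma coact_finitely_supported a f :
  finitely_supported f -> finitely_supported (coact a f).
Proof.
move=> fk; have [s [sh sE]] := homogeneous_decomposition_ex a.
have {}sh p : p \in s -> homogeneous p.1 p.2 by move=> /sh[].
have D0 : adic 0 (fun n => \sum_(p <- s) p.2 ** f (n - p.1)).
  apply: adic_sum => p; apply: (@adic_map _ _ (lumul p.2)).
  - exact: lumulBr.
  - exact: ideal_predMl.
  - exact: adic_shift.
apply: (@adic_ext 0 _ _ D0) => n.
by rewrite sE coact_decomposition// subrr rpred0.
Qed.

(* Modulo J the matrix [coact e] is idempotent and vanishes at [z = 1], so it is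
   divisible by every power of [z - 1], hence zero. *)
Lemma idempotent_matrix_graded n (e : 'I_n -> 'I_n -> A) :
  (forall i j, e i j = \sum_k e i k ** e k j) -> (forall i j, J (e i j)) ->
  forall i j, homogeneous_decomposition J (e i j).
Proof.
move=> ee eJ i j; have [s [sh eE]] := homogeneous_decomposition_ex (e i j).
have {}sh p : p \in s -> homogeneous p.1 p.2 by move=> /sh[].
have [u [_ us]] := local_unit [seq p.2 | p <- s].
(* The local unit [u] stands in for 1: the coefficients of [coact (e i j) w] are the homogeneous
   components of [e i j]. *)
pose w (m : int) : A := if m == 0 then u else 0.
(* The column [j] stays fixed and the row varies: idempotency expresses [coact (e i' j) w] through
   the entries of the same column, and each further coaction gains a factor z - 1. *)
have w_adic k : forall i, adic k (coact (e i j) w).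
  elim: k => [i'|k IHk i'].
    apply: coact_finitely_supported; exists 0, 1 => m mP.
    by rewrite /w ifF ?rpred0; lia.
  apply: (@adic_ext _ (fun m => \sum_l coact (e i' l) (coact (e l j) w) m)).
    by apply: adic_sum => l; apply: coact_adic => //; exact/ideal_predP.
  move=> m; rewrite [in X in inJ (X - _)]ee coact_sum.
  rewrite (eq_bigr (fun l => coact (e i' l) (coact (e l j) w) m)).
    by rewrite subrr rpred0.
  by move=> l _; rewrite coactM.
have wE m : coact (e i j) w m = \sum_(p <- s | p.1 == m) p.2.
  rewrite eE coact_decomposition// [RHS]big_mkcond; apply: eq_big_seq => p ps.
  rewrite /w subr_eq0 eq_sym; case: eqP => _; last exact: lumul0.
  by have [] := us p.2 (map_f _ ps).
have sJ m : J (\sum_(p <- s | p.1 == m) p.2).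
  rewrite -wE; apply/ideal_predP.
  have [lo [hi fJ]] := adic_finitely_supported (w_adic 0%N i).
  (* The power of z - 1 is chosen as the length of the support. *)
  apply: (@adic_kill _ _ lo (w_adic (absz (hi - lo)) i)) => l lP.
  by apply: (fJ l); lia.
(* Several terms of [s] may have the same degree, and only their sum is known to lie in [J]. *)
exists [seq (m, \sum_(p <- s | p.1 == m) p.2) | m <- undup (map fst s)].
split=> [_ /mapP[m _ ->] /=|].
  split=> //; rewrite big_seq_cond.
  apply: big_ind => [||p /andP[/sh ph /eqP<-]] //.
    exact: homogeneous0.
  by move=> x y; exact: homogeneousD.
rewrite big_map/= (exchange_big_dep predT)//= eE; apply: eq_big_seq => p ps.
rewrite big_mkcond (bigD1_seq p.1) ?undup_uniq ?mem_undup ?map_f//= eqxx.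
by rewrite big1 ?addr0// => m mp; rewrite eq_sym (negPf mp).
Qed.

End AdicFiltration.

End Grading.

(** * Graded ideals are generated by idempotents *)

Section HomogeneousIdempotents.
Context (F : fieldType) (G : digraph).
Local Notation A := (lpa F G).
Local Notation vtx := (@lpa_vertex_elt F G).
Local Notation arr := (@lpa_arrow_elt F G).
Local Notation gst := (@lpa_ghost_elt F G).

Inductive span (X : A -> Prop) : A -> Prop :=
| span0 : span X 0
| spanZD k x a : X x -> span X a -> span X (k *: x + a).

Lemma span_gen (X : A -> Prop) x : X x -> span X x.
Proof.
by move=> Xx; rewrite -[x]addr0 -[x]scale1r; exact: spanZD (span0 X).
Qed.

Lemma spanD (X : A -> Prop) a b : span X a -> span X b -> span X (a + b).
Proof.
move=> aX bX; elim: aX => [|k x {}a Xx _ IHa]; first by rewrite add0r.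
by rewrite -addrA; exact: spanZD.
Qed.

Lemma spanZ (X : A -> Prop) k a : span X a -> span X (k *: a).
Proof.
elim=> [|l x {}a Xx _ IHa]; first by rewrite scaler0; exact: span0.
by rewrite scalerDr scalerA; exact: spanZD.
Qed.

Lemma span_mulr (X Y : A -> Prop) b : (forall x, X x -> span Y (x ** b)) ->
  forall a, span X a -> span Y (a ** b).
Proof.
move=> XY a; elim=> [|k x {}a Xx _ IHa]; first by rewrite lu0mul; exact: span0.
by rewrite lumulDl lumulZl; apply: spanD => //; apply/spanZ/XY.
Qed.

Lemma span_sub (X Y : A -> Prop) : (forall x, X x -> Y x) ->
  forall a, span X a -> span Y a.
Proof.
by move=> XY a; elim=> [|k x {}a /XY Yx _ IHa]; [exact: span0|exact: spanZD].
Qed.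

(* These are 0 when p is not a path starting at u. *)
Fixpoint path_elt (u : vertex G) (p : seq (arrow G)) : A :=
  if p is e :: p' then vtx u ** arr e ** path_elt (tgt e) p' else vtx u.

Fixpoint ghost_path_elt (u : vertex G) (p : seq (arrow G)) : A :=
  if p is e :: p' then ghost_path_elt (tgt e) p' ** gst e ** vtx u else vtx u.

Lemma vtx_arr u e : vtx u ** arr e = if u == src e then arr e else 0.
Proof.
rewrite -{1}(src_arrow F e) lumulA vertexM; case: eqP => [->|_].
  exact: src_arrow.
exact: lu0mul.
Qed.

Lemma ghost_vtx e u : gst e ** vtx u = if src e == u then gst e else 0.
Proof.
rewrite -{1}(ghost_src F e) -lumulA vertexM; case: eqP => [_|_].
  exact: ghost_src.
exact: lumul0.
Qed.

Lemma vtx_ghost u e : vtx u ** gst e = if u == tgt e then gst e else 0.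
Proof.
rewrite -{1}(tgt_ghost F e) lumulA vertexM; case: eqP => [->|_].
  exact: tgt_ghost.
exact: lu0mul.
Qed.

Lemma ghost_path_vtx u v p :
  ghost_path_elt u p ** vtx v = if u == v then ghost_path_elt u p else 0.
Proof.
case: p => [|e p] /=; first by rewrite vertexM.
by rewrite -!lumulA vertexM; case: eqP => [->|]; rewrite ?lumul0.
Qed.

Lemma path_vtx u p v :
  path_elt u p ** vtx v = path_elt u p \/ path_elt u p ** vtx v = 0.
Proof.
elim: p u => [|e p IHp] u /=.
  by rewrite vertexM; case: eqP => _; [left|right].
by rewrite -lumulA; case: (IHp (tgt e)) => ->; [left|right; rewrite lumul0].
Qed.

Lemma path_rcons u p v e :
  path_elt u p ** vtx v ** arr e =
  if v == src e then path_elt u (rcons p e) else 0.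
Proof.
rewrite -lumulA vtx_arr; case: eqP => _; last by rewrite lumul0.
elim: p u => [|f p IHp] u /=; first by rewrite -lumulA arrow_tgt.
by rewrite -lumulA IHp.
Qed.

Lemma path_rcons_tgt u p e :
  path_elt u (rcons p e) ** vtx (tgt e) = path_elt u (rcons p e).
Proof.
have := path_rcons u p (src e) e; rewrite eqxx => <-.
by rewrite -lumulA arrow_tgt.
Qed.

(** The last ghost arrow of the first factor meets the first arrow of the second, and (CK1) cancels
    them. *)
Lemma ghost_path_cons u v e f p q :
  ghost_path_elt u (e :: p) ** path_elt v (f :: q) =
  if [&& u == v, e == f & src e == u]
  then ghost_path_elt (tgt e) p ** path_elt (tgt e) q else 0.
Proof.
suff -> : ghost_path_elt u (e :: p) ** path_elt v (f :: q) =
    ghost_path_elt (tgt e) p **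
      ((gst e ** vtx u) ** (vtx v ** arr f)) ** path_elt (tgt f) q.
  rewrite ghost_vtx vtx_arr; case: eqP => [<-|_]; last first.
    by rewrite !andbF lu0mul lumul0 lu0mul.
  have [vf|vf] := eqVneq v (src f); last first.
    rewrite lumul0 lumul0 lu0mul; case: ifP => // /and3P[/eqP ev /eqP ef _].
    by rewrite -ev ef eqxx in vf.
  rewrite ghost_arrow; case: (eqVneq e f) => [ef|_]; last first.
    by rewrite andbF lumul0 lu0mul.
  by rewrite vf -ef !eqxx /= ghost_path_vtx eqxx.
by rewrite /= !lumulA.
Qed.

Lemma ghost_path_path_eq0 u v p q : size p = size q -> (u, p) != (v, q) ->
  ghost_path_elt u p ** path_elt v q = 0.
Proof.
elim: p q u v => [|e p IHp] [|f q] // u v.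
  by move=> _; rewrite /= vertexM xpair_eqE andbT => /negPf->.
move=> [pq]; rewrite xpair_eqE eqseq_cons ghost_path_cons.
case: eqP => //= _; case: eqP => //= _ qp; case: eqP => // _.
by apply: IHp => //; rewrite xpair_eqE negb_and qp orbT.
Qed.

Lemma ghost_path_path u p :
  (exists v, ghost_path_elt u p ** path_elt u p = vtx v) \/
  ghost_path_elt u p ** path_elt u p = 0.
Proof.
elim: p u => [|e p IHp] u; first by left; exists u; rewrite /= vertexM eqxx.
by rewrite ghost_path_cons !eqxx /=; case: eqP => _; [exact: IHp|right].
Qed.

Lemma path_ghost_pathK u p :
  path_elt u p ** (ghost_path_elt u p ** path_elt u p) = path_elt u p.
Proof.
elim: p u => [|e p IHp] u; first by rewrite /= !vertexM !eqxx vertexM eqxx.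
rewrite ghost_path_cons !eqxx /=; case: eqP => [su|us].
  by rewrite -lumulA IHp.
by rewrite lumul0 vtx_arr eq_sym; case: eqP => // _; rewrite lu0mul.
Qed.

(** * Homogeneous elements as combinations of monomials *)

Definition path_of (n : int) (x : A) : Prop :=
  exists u p, (size p)%:Z = n /\ x = path_elt u p.

(** The degree is [n]; the bound [N] on the number of ghost arrows is what the induction in
    [homogeneous_in] runs on. *)
Definition monomial (N : nat) (n : int) (x : A) : Prop :=
  exists u p v q, [/\ (size q <= N)%N, (size p)%:Z - (size q)%:Z = n &
    x = path_elt u p ** ghost_path_elt v q].

Lemma span_monomial_leq N N' n a : (N <= N')%N ->
  span (monomial N n) a -> span (monomial N' n) a.
Proof.
move=> NN'; apply: span_sub => x [u [p [v [q [qN pq xE]]]]].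
by exists u, p, v, q; split=> //; exact: leq_trans NN'.
Qed.

Lemma span_if (X : A -> Prop) (b : bool) x :
  (b -> X x) -> span X (if b then x else 0).
Proof. by case: b => [Xx|_]; [exact/span_gen/Xx|exact: span0]. Qed.

Lemma monomial_vtx N n x w :
  monomial N n x -> span (monomial N n) (x ** vtx w).
Proof.
move=> [u [p [v [q [qN pq ->]]]]]; rewrite -lumulA ghost_path_vtx.
by rewrite [_ ** _]fun_if lumul0; apply: span_if => _; exists u, p, v, q.
Qed.

Lemma monomial_ghost N n x e :
  monomial N n x -> span (monomial N.+1 (n - 1)) (x ** gst e).
Proof.
move=> [u [p [v [q [qN pq ->]]]]].
rewrite -[ghost_path_elt v q](_ : ghost_path_elt v q ** vtx v = _); last first.
  by rewrite ghost_path_vtx eqxx.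
rewrite -!lumulA vtx_ghost; case: eqP => [->|_]; last first.
  by rewrite !lumul0; exact: span0.
apply: span_gen; exists u, p, (src e), (e :: q); split=> //=; first by lia.
by rewrite -!lumulA ghost_src.
Qed.

(** By (CK1) the arrow cancels the last ghost arrow or gives 0. If there is no ghost arrow, it
    extends the path or gives 0. *)
Lemma monomial_arrow N n x e :
  monomial N n x -> span (monomial N.-1 (n + 1)) (x ** arr e).
Proof.
move=> [u [p [v [q [qN pq ->]]]]]; case: q qN pq => [|f q] /= qN pq.
  rewrite path_rcons; apply: span_if => _.
  exists u, (rcons p e), (tgt e), [::]; split=> //.
    by rewrite size_rcons /=; lia.
  by rewrite /= path_rcons_tgt.
rewrite -!lumulA vtx_arr; case: eqP => [vE|_]; last first.
  by rewrite !lumul0; exact: span0.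
rewrite ghost_arrow [_ ** (if _ then _ else _)]fun_if lumul0.
rewrite ghost_path_vtx eqxx [_ ** (if _ then _ else _)]fun_if lumul0.
apply: span_if => _; exists u, p, (tgt f), q; split=> //; lia.
Qed.

(** The left factor [b] lets a product be absorbed one factor at a time; later [b] is a sum of
    vertices that acts as a unit on [a]. *)
Lemma homogeneous_span n a : homogeneous n a -> forall N m b,
  span (monomial N m) b -> exists N', span (monomial N' (m + n)) (b ** a).
Proof.
elim=> {n a} [v|e|e|n|n a b _ IHa _ IHb|n k a _ IHa
  |n k a b _ IHa _ IHb] N m c cN.
- exists N; rewrite addr0; apply: span_mulr cN => x; exact: monomial_vtx.
- exists N.-1; apply: span_mulr cN => x; exact: monomial_arrow.
- exists N.+1; apply: span_mulr cN => x; exact: monomial_ghost.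
- by exists 0%N; rewrite lumul0; exact: span0.
- have [N1 aN1] := IHa _ _ _ cN; have [N2 bN2] := IHb _ _ _ cN.
  exists (maxn N1 N2); rewrite lumulDr.
  apply: spanD; first exact: (span_monomial_leq (leq_maxl _ _) aN1).
  exact: (span_monomial_leq (leq_maxr _ _) bN2).
- have [N1 aN1] := IHa _ _ _ cN; exists N1; rewrite lumulZr; exact: spanZ.
- have [N1 aN1] := IHa _ _ _ cN; have [N2 bN2] := IHb _ _ _ aN1.
  by exists N2; rewrite lumulA addrA.
Qed.

Definition vtx_sum (s : seq (vertex G)) : A := \sum_(v <- s) vtx v.

Lemma vtx_sum_l s v : uniq s -> v \in s -> vtx_sum s ** vtx v = vtx v.
Proof.
move=> sU vs; rewrite lumul_suml (bigD1_seq v)//= vertexM eqxx.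
by rewrite big1 ?addr0// => u uv; rewrite vertexM (negPf uv).
Qed.

Lemma vtx_sum_r s v : uniq s -> v \in s -> vtx v ** vtx_sum s = vtx v.
Proof.
move=> sU vs; rewrite lumul_sumr (bigD1_seq v)//= vertexM eqxx.
by rewrite big1 ?addr0// => u uv; rewrite vertexM eq_sym (negPf uv).
Qed.

Lemma vtx_sum_unit a :
  exists s, uniq s /\ vtx_sum s ** a = a /\ a ** vtx_sum s = a.
Proof.
(* Asking for all larger lists of vertices allows the lists of two subterms to be concatenated. *)
suff [s sP] : exists s : seq (vertex G), forall t, uniq t -> {subset s <= t} ->
    vtx_sum t ** a = a /\ a ** vtx_sum t = a.
  exists (undup s); rewrite undup_uniq; split=> //.
  by apply: sP; [exact: undup_uniq|move=> v; rewrite mem_undup].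
have gen u v b : vtx u ** b = b -> b ** vtx v = b ->
    exists s : seq (vertex G), forall t, uniq t -> {subset s <= t} ->
    vtx_sum t ** b = b /\ b ** vtx_sum t = b.
  move=> ub bv; exists [:: u; v] => t tU st; split.
    by rewrite -ub lumulA vtx_sum_l// st// !inE eqxx.
  by rewrite -bv -lumulA vtx_sum_r// st// !inE eqxx orbT.
have [x {a}->] := lpa_pi_surj a.
elim: x => [v|e|e||x [s sP]|x [s sP] y [t tP]|k x [s sP]|x [s sP] y [t tP]].
- by apply: (gen v v); rewrite vertexM eqxx.
- by apply: (gen (src e) (tgt e)); [exact: src_arrow|exact: arrow_tgt].
- by apply: (gen (tgt e) (src e)); [exact: tgt_ghost|exact: ghost_src].
- by exists [::] => t _ _; rewrite lumul0 lu0mul.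
- exists s => t tU /(sP _ tU)[E1 E2].
  by rewrite lpa_piN lumulNl lumulNr E1 E2.
- exists (s ++ t) => r rU str.
  have [|E1 E2] := sP r rU; first by move=> z zs; rewrite str// mem_cat zs.
  have [|E3 E4] := tP r rU; first by move=> z zt; rewrite str// mem_cat zt orbT.
  by rewrite lpa_piD lumulDl lumulDr E1 E2 E3 E4.
- exists s => t tU /(sP _ tU)[E1 E2].
  by rewrite lpa_piZ lumulZl lumulZr E1 E2.
- exists (s ++ t) => r rU str.
  have [|E1 E2] := sP r rU; first by move=> z zs; rewrite str// mem_cat zs.
  have [|E3 E4] := tP r rU; first by move=> z zt; rewrite str// mem_cat zt orbT.
  by rewrite lpa_piM lumulA E1 -lumulA E4.
Qed.

Lemma homogeneous_monomials n a : homogeneous n a ->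
  exists N, span (monomial N n) a.
Proof.
move=> an; have [s [_ [sa _]]] := vtx_sum_unit a.
suff s0 : span (monomial 0 0) (vtx_sum s).
  by have [N] := homogeneous_span an s0; rewrite add0r sa; exists N.
apply: big_ind => [||v _]; [exact: span0|exact: spanD|apply: span_gen].
by exists v, [::], v, [::]; rewrite /= vertexM eqxx.
Qed.

(** * The idempotents that remain when some e e^* are subtracted from a vertex *)

Definition vtx_diff (v : vertex G) (s : seq (arrow G)) : A :=
  vtx v - \sum_(e <- s) arr e ** gst e.

Section VertexDifference.
Variables (v : vertex G) (s : seq (arrow G)).
Hypotheses (sU : uniq s) (sv : forall e, e \in s -> src e = v).

Lemma vtx_vtx_diff u :
  vtx u ** vtx_diff v s = if u == v then vtx_diff v s else 0.
Proof.
rewrite lumulBr vertexM lumul_sumr.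
rewrite (eq_big_seq (fun e => if u == v then arr e ** gst e else 0));
  last first.
  move=> e /sv se; rewrite lumulA vtx_arr se.
  by case: eqP => // _; rewrite lu0mul.
by case: eqP => [->//|_]; rewrite big1 ?subr0.
Qed.

Lemma ghost_vtx_diff e : e \in s -> gst e ** vtx_diff v s = 0.
Proof.
move=> es; rewrite lumulBr ghost_vtx (sv es) eqxx lumul_sumr (bigD1_seq e)//=.
rewrite lumulA ghost_arrow eqxx tgt_ghost big1 ?addr0 ?subrr// => f fe.
by rewrite lumulA ghost_arrow eq_sym (negPf fe) lu0mul.
Qed.

Lemma vtx_diffM : vtx_diff v s ** vtx_diff v s = vtx_diff v s.
Proof.
rewrite {1}/vtx_diff lumulBl vtx_vtx_diff eqxx lumul_suml.
rewrite big_seq big1 ?subr0// => e es.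
by rewrite -lumulA ghost_vtx_diff// lumul0.
Qed.

End VertexDifference.

Lemma ghost_vtx_diff_src e v s :
  src e != v -> (forall f, f \in s -> src f = v) ->
  gst e ** vtx_diff v s = 0.
Proof.
move=> ev sv; rewrite lumulBr ghost_vtx (negPf ev) sub0r lumul_sumr.
rewrite big_seq big1 ?oppr0// => f fs; rewrite lumulA ghost_arrow.
case: eqP => [ef|_]; last exact: lu0mul.
by rewrite ef sv// eqxx in ev.
Qed.

(** In the application [K] is [psi (phi J)], which contains each idempotent [u] of [J] because the
    module uA is orthogonal to [J]. *)
Variables J K : ideal A.
Hypothesis idem_le : forall u : A, u ** u = u -> J u -> K u.

(* For [p] of length n, [p^* c w] is a multiple of [w]; if none is nonzero then
   [c w = \sum_p p p^* c w] vanishes. *)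
Lemma path_diff_in n c v s : uniq s -> (forall e, e \in s -> src e = v) ->
  span (path_of n) c -> J (c ** vtx_diff v s) -> K (c ** vtx_diff v s).
Proof.
move=> sU sv cn; set w := vtx_diff v s => cwJ.
have [_ _ KZ KMl _] := ideal_axiom K; have [_ _ JZ JMl _] := ideal_axiom J.
(* For a path x of the same length, p^* x is a vertex or 0, and a vertex times [w] is [w] or 0. *)
have scal u p : (size p)%:Z = n ->
    exists k, ghost_path_elt u p ** (c ** w) = k *: w.
  move=> pn; elim: cn => [|k x c' [u' [q [qn ->]]] _ [k' IH]].
    by exists 0; rewrite lu0mul lumul0 scale0r.
  rewrite lumulDl lumulDr {}IH lumulZl lumulZr lumulA.
  suff [l ->] : exists l, ghost_path_elt u p ** path_elt u' q ** w = l *: w.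
    by exists (k * l + k'); rewrite scalerA scalerDl.
  have [[<- <-]|pq] := eqVneq (u, p) (u', q); last first.
    exists 0; rewrite ghost_path_path_eq0 ?lu0mul ?scale0r//.
    by move: pn qn => <- [].
  have [[t ->]|->] := ghost_path_path u p; last first.
    by exists 0; rewrite lu0mul scale0r.
  rewrite vtx_vtx_diff//; case: eqP => _; first by exists 1; rewrite scale1r.
  by exists 0; rewrite scale0r.
have [[u [p [pn pcw]]]|noz] := pselect
    (exists u p, (size p)%:Z = n /\ ghost_path_elt u p ** (c ** w) <> 0).
  have [k kE] := scal u p pn; apply: KMl; apply: idem_le.
    exact: vtx_diffM.
  have k0 : k != 0 by apply: contra_not_neq pcw => k0; rewrite kE k0 scale0r.
  rewrite -[w]scale1r -(mulVf k0) -scalerA -kE.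
  exact/JZ/JMl.
suff [r [rU [rn rE]]] : exists r : seq (vertex G * seq (arrow G)),
    uniq r /\ (forall q, q \in r -> (size q.2)%:Z = n) /\
    c = \sum_(q <- r) path_elt q.1 q.2 ** (ghost_path_elt q.1 q.2 ** c).
  have -> : c ** w = 0.
    rewrite rE lumul_suml big_seq big1// => q /rn qn.
    rewrite -!lumulA.
    have [->|q0] := eqVneq (ghost_path_elt q.1 q.2 ** (c ** w)) 0.
      exact: lumul0.
    by case: noz; exists q.1, q.2; split=> //; exact/eqP.
  by have [] := ideal_axiom K.
(* The terms of [c] have to be expanded over a common index list, so [r] may be enlarged; additional
   paths of length [n] contribute 0 by orthogonality. *)
suff [r [rn rP]] : exists r : seq (vertex G * seq (arrow G)),
    (forall q, q \in r -> (size q.2)%:Z = n) /\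
    forall r', uniq r' -> (forall q, q \in r' -> (size q.2)%:Z = n) ->
      {subset r <= r'} ->
    c = \sum_(q <- r') path_elt q.1 q.2 ** (ghost_path_elt q.1 q.2 ** c).
  exists (undup r); rewrite undup_uniq; split=> //.
  have rn' q : q \in undup r -> (size q.2)%:Z = n by rewrite mem_undup => /rn.
  by split=> //; apply: rP => // [|q]; rewrite ?undup_uniq// mem_undup.
elim: cn => [|k x c' [u [p [pn ->]]] _ [r [rn rP]]].
  exists [::]; split=> // r' _ _ _; rewrite big1// => q _; rewrite !lumul0//.
exists ((u, p) :: r); split=> [q|r' rU' rn' rr'].
  by rewrite inE => /predU1P[->//|/rn].
rewrite [in LHS](rP r')// => [|q qr]; last by rewrite rr'// inE qr orbT.
rewrite [in LHS](_ : path_elt u p =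
  \sum_(q <- r') path_elt q.1 q.2 ** (ghost_path_elt q.1 q.2 ** path_elt u p)).
  rewrite scaler_sumr -big_split; apply: eq_bigr => q _ /=.
  by rewrite !lumulDr !lumulZr.
rewrite (bigD1_seq (u, p)) ?rr' ?mem_head//= path_ghost_pathK.
rewrite big_seq_cond big1 ?addr0// => q /andP[/rn' qn qup].
rewrite ghost_path_path_eq0 ?lumul0// -?surjective_pairing//.
by move: pn qn => <- [].
Qed.

(** Here [s] lists the arrows e whose e^* ends a monomial of [a]. The factor [vtx_diff v t] kills
    these monomials, and the remaining ones are paths of length [n] or vanish. *)
Lemma monomial_diff N n a v : span (monomial N n) a ->
  exists s : seq (arrow G),
    forall t, uniq t -> (forall e, e \in t -> src e = v) ->
    {subset [seq e <- s | src e == v] <= t} ->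
    exists c, span (path_of n) c /\ a ** vtx_diff v t = c ** vtx_diff v t.
Proof.
elim=> [|k x b [u [p [u' [[|e q] [_ pq ->]]]]] _ [s sP]].
- by exists [::] => t _ _ _; exists 0; split; [exact: span0|].
- exists s => t tU tv /(sP t tU tv)[c [cn cE]].
  exists (k *: (path_elt u p ** vtx u') + c); split; last first.
    by rewrite !lumulDl cE.
  apply: spanD => //; apply: spanZ.
  have [->|->] := path_vtx u p u'; last exact: span0.
  by apply: span_gen; exists u, p; split=> //; move: pq; rewrite subr0.
- exists (e :: s) => t tU tv st.
  have [|c [cn cE]] := sP t tU tv.
    by move=> f; rewrite mem_filter => /andP[fv fs];
      rewrite st// mem_filter fv inE fs orbT.
  exists c; split=> //; rewrite lumulDl cE lumulZl.
  rewrite [X in X + _](_ : _ = 0) ?add0r//= -!lumulA vtx_vtx_diff//.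
  case: eqP => _; last by rewrite !lumul0 scaler0.
  have [ev|ev] := eqVneq (src e) v; last first.
    by rewrite ghost_vtx_diff_src// !lumul0 scaler0.
  rewrite ghost_vtx_diff ?lumul0 ?scaler0//.
  by rewrite st// mem_filter ev eqxx mem_head.
Qed.

Lemma homogeneous_in n a : homogeneous n a -> J a -> K a.
Proof.
have [K0 KD _ _ KMr] := ideal_axiom K; have [_ _ _ _ JMr] := ideal_axiom J.
have split_vtx b : (forall v, K (b ** vtx v)) -> K b.
  move=> bK; have [s [_ [_ <-]]] := vtx_sum_unit b.
  by rewrite lumul_sumr; apply: big_ind.
move=> /homogeneous_monomials[N]; elim: N n a => [|N IHN] n a aN aJ.
  have {}aN : span (path_of n) a.
    elim: aN => [|k x b [u [p [v [q [q0 pn ->]]]]] _ bP]; first exact: span0.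
    apply: spanD => //; apply: spanZ; case: q q0 pn => //= _ pn.
    have [->|->] := path_vtx u p v; last exact: span0.
    by apply: span_gen; exists u, p; split=> //; move: pn; rewrite subr0.
  (* Without ghost arrows nothing has to be subtracted from the vertex. *)
  have vE v : vtx v = vtx_diff v [::] by rewrite /vtx_diff big_nil subr0.
  apply: split_vtx => v; rewrite vE.
  by apply: (@path_diff_in n) => //; exact: JMr.
apply: split_vtx => v; have [s sP] := monomial_diff v aN.
pose t := undup [seq e <- s | src e == v].
have tv e : e \in t -> src e = v by rewrite mem_undup mem_filter => /andP[/eqP].
have [|c [cn cE]] := sP t (undup_uniq _) tv.
  by move=> e; rewrite mem_undup.
(* With w := [vtx_diff v t] this is a v = a w + \sum_e a e e^*, where a w reduces to paths and a e
   has a smaller bound on its ghost arrows. *)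
rewrite -[vtx v](subrK (\sum_(e <- t) arr e ** gst e)) lumulDr; apply: (KD _ _).
  rewrite [X in K X]cE; apply: (@path_diff_in n) => //; first exact: undup_uniq.
  by rewrite -cE; exact: JMr.
rewrite lumul_sumr; apply: big_ind => [||e _]; [exact: K0|exact: KD|].
rewrite lumulA; apply: KMr.
apply: (IHN (n + 1)); last exact: JMr.
by apply: span_mulr aN => x; exact: monomial_arrow.
Qed.

End HomogeneousIdempotents.

(** * The lattice isomorphism *)

Section OrderTransport.
Variables (T U : Type) (C : T -> Prop) (D : U -> Prop).
Variables (leT : T -> T -> Prop) (leU : U -> U -> Prop).
Variables (f : T -> U) (g : U -> T).
Hypothesis fg : inverse_bijections C D f g.
Hypothesis f_le : forall x y, leT x y -> leU (f x) (f y).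
Hypothesis g_le : forall x y, leU x y -> leT (g x) (g y).

Lemma transport_join x y z : C x -> C y ->
  is_join C leT x y z -> is_join D leU (f x) (f y) (f z).
Proof.
have [fD gC gfK fgK] := fg => Cx Cy [Cz xz yz zmin].
split=> [|||w Dw xw yw]; [exact: fD|exact: f_le|exact: f_le|].
rewrite -(fgK w Dw); apply/f_le/zmin; first exact: gC.
  by rewrite -(gfK x Cx); exact: g_le.
by rewrite -(gfK y Cy); exact: g_le.
Qed.

Lemma transport_meet x y z : C x -> C y ->
  is_meet C leT x y z -> is_meet D leU (f x) (f y) (f z).
Proof.
have [fD gC gfK fgK] := fg => Cx Cy [Cz zx zy zmax].
split=> [|||w Dw wx wy]; [exact: fD|exact: f_le|exact: f_le|].
rewrite -(fgK w Dw); apply/f_le/zmax; first exact: gC.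
  by rewrite -(gfK x Cx); exact: g_le.
by rewrite -(gfK y Cy); exact: g_le.
Qed.

End OrderTransport.

Section ClosedSubmonoids.
Context (F : fieldType) (A : luAlgType F).
Local Notation closed := (closed_submonoid (A := A)).

Lemma vsubset_antisym (X Y : vmonoid A -> Prop) :
  vsubset X Y -> vsubset Y X -> X = Y.
Proof.
move=> XY YX; apply: functional_extensionality_dep => p.
by apply/propext; split=> [/XY|/YX].
Qed.

Lemma ideal_le_antisym (I J : ideal A) : ideal_le I J -> ideal_le J I -> I = J.
Proof.
move=> IJ JI; apply/ideal_eq/functional_extensionality_dep => a.
by apply/propext; split=> [/IJ|/JI].
Qed.

Lemma phi_le (I J : ideal A) : ideal_le I J -> vsubset (phi I) (phi J).
Proof.
move=> IJ p; have [P ->] := iso_class_surj p.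
by move=> /phi_iso_class PI; apply/phi_iso_class; exact: perp_le PI.
Qed.

Lemma psi_le (X Y : vmonoid A -> Prop) :
  vsubset X Y -> ideal_le (psi X) (psi Y).
Proof. by move=> XY a aX I YI; apply: aX => P /XY; exact: YI. Qed.

(** This serves both lattice operations: the join is the intersection of all closed submonoids above
    both, the meet that of the two. *)
Lemma closed_submonoid_bigcap (Z : (vmonoid A -> Prop) -> Prop) :
  (forall S, Z S -> closed S) -> closed (fun p => forall S, Z S -> S p).
Proof.
move=> Zcl; split=> [S /Zcl[]//|p q Sp Sq S ZS|p q Sp pq S ZS].
  by have [_ SD _] := Zcl S ZS; apply: SD; [exact: Sp|exact: Sq].
by have [_ _ Sepi] := Zcl S ZS; apply: Sepi pq; exact: Sp.
Qed.

Lemma closed_submonoid_lattice : is_lattice closed (@vsubset F A).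
Proof.
split=> [X _ p //|X Y _ _|X Y Z _ _ _ XY YZ p /XY/YZ//|X Y cX cY|X Y cX cY].
- exact: vsubset_antisym.
- exists (fun p => forall S, [/\ closed S, vsubset X S & vsubset Y S] -> S p).
  split=> [|p Xp S [_ XS _]|p Yp S [_ _ YS]|W cW XW YW p Zp].
  + by apply: closed_submonoid_bigcap => S [].
  + exact: XS.
  + exact: YS.
  + exact: Zp.
- exists (fun p => forall S, S = X \/ S = Y -> S p).
  split=> [|p Zp|p Zp|W cW WX WY p Wp S [->|->]].
  + by apply: closed_submonoid_bigcap => S [->|->].
  + by apply: Zp; left.
  + by apply: Zp; right.
  + exact: WX.
  + exact: WY.
Qed.

End ClosedSubmonoids.

Section GradedIdeals.
Context (F : fieldType) (G : digraph).
Local Notation A := (lpa F G).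

(** This is the largest graded ideal inside [J]. *)
Lemma homogeneous_part_ideal (J : ideal A) :
  is_ideal (homogeneous_decomposition J).
Proof.
have [J0 JD JZ JMl JMr] := ideal_axiom J.
split=> [|x y|k x|a x|a x].
- by exists [::]; rewrite big_nil.
- exact: homogeneous_decompositionD.
- by apply: homogeneous_decompositionZ; exact: JZ.
- apply: homogeneous_decompositionM (homogeneous_decomposition_ex a).
  by move=> y z _; exact: JMl.
- move=> xJ.
  apply: homogeneous_decompositionM xJ (homogeneous_decomposition_ex a).
  by move=> y z Jy _; exact: JMr.
Qed.

(** By [idempotent_matrix_graded] the homogeneous part of [psi X] is still orthogonal to all members
    of [X]; as [psi X] is the least such ideal, it equals that part. *)
Lemma psi_graded (X : vmonoid A -> Prop) : graded_ideal (psi X).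
Proof.
move=> a aX; apply: (aX (Ideal (homogeneous_part_ideal (psi X)))) => P XP.
have [n [e [ee eP]]] := perp_matrix P; apply/eP.
apply: idempotent_matrix_graded => // i j.
exact: ((eP _).1 (perp_psi XP)).
Qed.

(** One inclusion is the Galois connection. For the other, an element of [J] is a sum of homogeneous
    elements of [J], to which [homogeneous_in] applies. *)
Lemma psi_phi_graded (J : ideal A) : graded_ideal J -> psi (phi J) = J.
Proof.
move=> Jgr; apply: ideal_le_antisym; first exact/phi_psi_galois.
move=> a /Jgr[s [sJ ->]]; have [K0 KD _ _ _] := ideal_axiom (psi (phi J)).
rewrite big_seq; apply: big_ind => [||p /sJ[ph pJ]]; [exact: K0|exact: KD|].
apply: homogeneous_in ph pJ => u uu uJ.
have [P PE] := idempotent_fgproj uu.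
by apply/PE/perp_psi/phi_iso_class/PE.
Qed.

Lemma psi_phi_bijections :
  inverse_bijections closed_submonoid (graded_ideal (F := F) (G := G)) psi phi.
Proof.
split=> [S _|J _|S|J]; first exact: psi_graded.
- exact: phi_closed.
- exact: phi_psi_closed.
- exact: psi_phi_graded.
Qed.

Lemma phi_psi_bijections :
  inverse_bijections (graded_ideal (F := F) (G := G)) closed_submonoid phi psi.
Proof. by have [? ? ? ?] := psi_phi_bijections; split. Qed.

(** Joins and meets are carried over from the closed submonoids along the monotone bijection
    [psi]. *)
Lemma graded_ideal_lattice :
  is_lattice (graded_ideal (F := F) (G := G)) (@ideal_le F A).
Proof.
have [_ _ _ joinP meetP] := closed_submonoid_lattice A.
have bij := psi_phi_bijections; have [_ phi_cl _ psi_phiK] := bij.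
split=> [I _ a //|I J _ _|I J K _ _ _ IJ JK a /IJ/JK//|I J Igr Jgr|I J Igr Jgr].
- exact: ideal_le_antisym.
- have [S IJS] := joinP _ _ (phi_cl I Igr) (phi_cl J Jgr); exists (psi S).
  rewrite -(psi_phiK I Igr) -(psi_phiK J Jgr).
  exact: (transport_join bij (@psi_le _ _) (@phi_le _ _) (phi_cl I Igr)
    (phi_cl J Jgr) IJS).
- have [S IJS] := meetP _ _ (phi_cl I Igr) (phi_cl J Jgr); exists (psi S).
  rewrite -(psi_phiK I Igr) -(psi_phiK J Jgr).
  exact: (transport_meet bij (@psi_le _ _) (@phi_le _ _) (phi_cl I Igr)
    (phi_cl J Jgr) IJS).
Qed.

End GradedIdeals.

Theorem theorem12 (F : fieldType) (G : digraph) :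
  [/\ (forall (X : vmonoid (lpa F G) -> Prop) (J : ideal (lpa F G)),
         vsubset X (phi J) <-> ideal_le (psi X) J),
      (forall J : ideal (lpa F G), (exists X, psi X = J) <-> graded_ideal J),
      (forall S : vmonoid (lpa F G) -> Prop,
         (exists J, phi J = S) <-> closed_submonoid S),
      inverse_bijections (graded_ideal (F := F) (G := G)) closed_submonoid phi psi &
      [/\ is_lattice (graded_ideal (F := F) (G := G)) ideal_le,
          is_lattice (closed_submonoid (A := lpa F G)) vsubset &
          lattice_morphism (graded_ideal (F := F) (G := G)) ideal_le
            closed_submonoid vsubset phi]].
Proof.
split=> [X J|J|S||].
- exact: phi_psi_galois.
- split=> [[X <-]|Jgr]; first exact: psi_graded.
  by exists (phi J); exact: psi_phi_graded.
- split=> [[J <-]|Scl]; first exact: phi_closed.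
  by exists (psi S); exact: phi_psi_closed.
- exact: phi_psi_bijections.
split; [exact: graded_ideal_lattice|exact: closed_submonoid_lattice|].
move=> I J K Igr Jgr; have bij := phi_psi_bijections F G.
split; [apply: (transport_join bij)|apply: (transport_meet bij)] => //;
  by [exact: phi_le|exact: psi_le].
Qed.
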